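(* Suppose $f$ is Krasner analytic on the arc $\mathcal{A}(a,b)\subset\mathbb{C}_p$ and $r = |a - b|_{p}$. Let $x(t)$ be a holomorphic, one-to-one, onto mapping from a closed disc $D^{+}(a_{1},R)$ to $D^{+}(a,r)$ with $x(a_{1}) = a$. Let $b_{1} = x^{-1}(b)$. Let $\alpha \in \mathbb{Z}_{\geq 0}$. Then $$\int_{\mathcal{A}(a,b),\Phi_{\alpha}}f(x)\,dx = \int_{\mathcal{A}(a_1,b_1),\Phi_{\alpha}}f(x(t))\,x'(t)\,dt ,$$ both integrals existing.
   Context: $p$ is an odd prime; $\mathbb{C}_p$ is the completion of an algebraic closure of $\mathbb{Q}_p$, with $|p|_p=1/p$. $D^+(c,r)$ is the closed disc with center $c$ and radius $r$. A function on a disc $D$ is holomorphic if it is given by a single power series convergent on $D$. Arc: for $a\ne b$ in $\mathbb{C}_p$ with $R=|a-b|_p$, the arc $\mathcal{A}(a,b)$ is the open disc $\{x : |x-b|_p<R\}$. A function on $\mathcal{A}(a,b)$ is Krasner analytic if it is the uniform limit on $\mathcal{A}(a,b)$ of rational functions having no poles in $\mathcal{A}(a,b)$. Path sequence: a function $\varphi$ defined for all integers $k\ge k_0$ (some $k_0\in\mathbb{Z}^+$), with values in $\mathbb{Z}^+$ and strictly increasing. For $f:\mathcal{A}(a,b)\to\mathbb{C}_p$ put $A_{f,\varphi}(k)=p^{-\varphi(k)}\sum_{\zeta}(x-a)f(x)$, where $x=a+(b-a)\zeta$ and $\zeta$ runs through the $p^{\varphi(k)}$-th roots of unity. A non-empty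 family $\Phi$ of path sequences is interlocked if for all $\varphi_1,\varphi_2\in\Phi$ there are $\varphi_3\in\Phi$ and $k_0$ such that $\varphi_3(k)$, $k\ge k_0$, is a subsequence of both $\varphi_1$ and $\varphi_2$. For interlocked $\Phi$, $\int_{\mathcal{A}(a,b),\Phi}f(x)\,dx=L$ means: for every $\varepsilon>0$ there are $\varphi_\varepsilon\in\Phi$ and $K_\varepsilon$ with $|A_{f,\varphi_\varepsilon}(k)-L|_p<\varepsilon$ for all $k>K_\varepsilon$ (such $L$ is unique if it exists). For $\alpha\in\mathbb{Z}$, $\Phi_\alpha$ is the interlocked family $\{\varphi : \varphi(k)=\alpha+\lambda k,\ \lambda=1,2,\dots\}$. *)

(* Defs.v *)
From mathcomp Require Export all_boot all_order all_algebra.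
From mathcomp Require Export mathcomp_extra boolp classical_sets functions.
From mathcomp Require Export cardinality fsbigop reals topology normedtype.
From mathcomp Require Import zify.

Set Implicit Arguments.
Unset Strict Implicit.
Unset Printing Implicit Defensive.

Export Order.TTheory GRing.Theory Num.Theory numFieldNormedType.Exports.
Local Open Scope classical_set_scope.
Local Open Scope ring_scope.

Section Valued.
Context {R : realType} {K : fieldType}.
Implicit Types (v : K -> R) (u : nat -> K) (f : K -> K).

Definition nonarch_abs v : Prop :=
  [/\ forall x, 0 <= v x,
      forall x, v x = 0 <-> x = 0,
      forall x y, v (x * y) = v x * v y
    & forall x y, v (x + y) <= Num.max (v x) (v y)].

Definition vcvg v u (l : K) : Prop :=
  (fun n => v (u n - l)) @ \oo --> (0 : R).

Definition vcauchy v u : Prop :=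
  forall e : R, 0 < e ->
    exists N : nat, forall m n, (N <= m)%N -> (N <= n)%N -> v (u m - u n) < e.

Definition vcomplete v : Prop :=
  forall u, vcauchy v u -> exists l, vcvg v u l.

Definition closed_disc v (c : K) (r : R) : set K := [set x | v (x - c) <= r].

Definition arc v (a b : K) : set K := [set x | v (x - b) < v (a - b)].

Definition holomorphic_on_disc v (c : K) (r : R) f : Prop :=
  exists u : nat -> K, forall t, closed_disc v c r t ->
    vcvg v (fun n => \sum_(0 <= i < n) u i * (t - c) ^+ i) (f t).

Definition is_vderiv v f (t d : K) : Prop :=
  forall e : R, 0 < e -> exists2 delta : R, 0 < delta &
    forall h, h != 0 -> v h < delta -> v ((f (t + h) - f t) / h - d) < e.

(* The value 0 is used at the points where [f] is not differentiable. *)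
Definition vderiv v f (t : K) : K := xget 0 [set d | is_vderiv v f t d].

(* The rational function [P n / Q n] has no pole on [D] when [Q n] does not
   vanish there; conversely, a rational function without poles on [D] has such
   a representation, in lowest terms. *)
Definition krasner_analytic v (D : set K) f : Prop :=
  exists P Q : nat -> {poly K},
    (forall n x, D x -> (Q n).[x] != 0) /\
    (forall e : R, 0 < e -> exists N : nat, forall n, (N <= n)%N ->
       forall x, D x -> v ((P n).[x] / (Q n).[x] - f x) < e).

End Valued.

(* The p-adic absolute value of [rat], normalized by |p| = 1/p. *)
Definition padic_abs (R : realType) (p : nat) (q : rat) : R :=
  if q == 0 then 0
  else p%:R ^ ((logn p `|denq q|)%:Z - (logn p `|numq q|)%:Z).

Definition is_completion (R : realType) (K L : fieldType)
    (vK : K -> R) (vL : L -> R) (i : {rmorphism K -> L}) : Prop :=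
  [/\ nonarch_abs vL,
      vcomplete vL,
      forall x, vL (i x) = vK x
    & forall y (e : R), 0 < e -> exists x, vL (y - i x) < e].

Definition is_algebraic_closure (K L : fieldType) (j : {rmorphism K -> L}) :=
  GRing.closed_field_axiom L /\ forall x : L, algebraicOver j x.

(* [C], with the absolute value [v], is the completion of an algebraic closure
   of the field of p-adic numbers, itself the completion of [rat] for
   [padic_abs p]; this determines [(C, v)] up to isometric isomorphism. *)
Definition is_Cp (R : realType) (p : nat) (C : fieldType) (v : C -> R) : Prop :=
  exists (Qp : fieldType) (vQp : Qp -> R) (i : {rmorphism rat -> Qp})
         (Qpbar : fieldType) (vbar : Qpbar -> R) (j : {rmorphism Qp -> Qpbar})
         (k : {rmorphism Qpbar -> C}),
    [/\ is_completion (padic_abs R p) vQp i,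
        is_algebraic_closure j,
        nonarch_abs vbar,
        forall x, vbar (j x) = vQp x
      & is_completion vbar v k].

(* A path sequence is only meaningful on the integers [k >= start]; the values
   of [path] below [start] are never used. *)
Record path_sequence := PathSequence {
  start : nat;
  path :> nat -> nat;
  start_gt0 : (0 < start)%N;
  path_gt0 : forall k, (start <= k)%N -> (0 < path k)%N;
  path_incr : forall k l, (start <= k)%N -> (k < l)%N -> (path k < path l)%N
}.

Definition subsequence_from (k0 : nat) (phi psi : path_sequence) : Prop :=
  exists s : nat -> nat,
    (forall k l, (k0 <= k)%N -> (k < l)%N -> (s k < s l)%N) /\
    (forall k, (k0 <= k)%N -> (start psi <= s k)%N /\ phi k = psi (s k)).

Definition interlocked (Phi : set path_sequence) : Prop :=
  Phi !=set0 /\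
  forall phi1 phi2, Phi phi1 -> Phi phi2 ->
    exists phi3 (k0 : nat),
      [/\ Phi phi3, (start phi3 <= k0)%N, subsequence_from k0 phi3 phi1
        & subsequence_from k0 phi3 phi2].

Record interlocked_family := InterlockedFamily {
  family : set path_sequence;
  familyP : interlocked family
}.

Definition linear_paths (alpha : int) : set path_sequence :=
  [set phi | exists2 lambda : nat, (0 < lambda)%N &
     forall k, (start phi <= k)%N -> (phi k)%:Z = alpha + (lambda * k)%N%:Z].

Lemma linear_paths_ex (alpha : int) (lambda : nat) : (0 < lambda)%N ->
  exists phi : path_sequence, start phi = `|alpha|.+1%N /\
    forall k, (start phi <= k)%N -> (phi k)%:Z = alpha + (lambda * k)%N%:Z.
Proof.
move=> l0.
have pos k : (`|alpha|.+1 <= k)%N -> 0 < alpha + (lambda * k)%N%:Z by nia.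
pose f (k : nat) := absz (alpha + (lambda * k)%N%:Z).
have fE k : (`|alpha|.+1 <= k)%N -> (f k)%:Z = alpha + (lambda * k)%N%:Z.
  by move=> /pos; rewrite /f; lia.
have f0 k : (`|alpha|.+1 <= k)%N -> (0 < f k)%N.
  by move=> hk; have := pos _ hk; have := fE _ hk; lia.
have fI k l : (`|alpha|.+1 <= k)%N -> (k < l)%N -> (f k < f l)%N.
  move=> hk kl; have hl : (`|alpha|.+1 <= l)%N by lia.
  by have := fE _ hk; have := fE _ hl; nia.
by exists (@PathSequence `|alpha|.+1%N f isT f0 fI).
Qed.

Lemma linear_paths_interlocked (alpha : int) : interlocked (linear_paths alpha).
Proof.
split.
  have [phi [_ phiE]] := @linear_paths_ex alpha 1 isT.
  by exists phi; exists 1%N.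
move=> phi1 phi2 [l1 l10 E1] [l2 l20 E2].
have l0 : (0 < l1 * l2)%N by rewrite muln_gt0 l10.
have [phi [_ phiE]] := linear_paths_ex alpha l0.
exists phi, (maxn (start phi) (maxn (start phi1) (start phi2))).
split; first by exists (l1 * l2)%N.
- by rewrite leq_maxl.
- exists (fun k => l2 * k)%N; split=> [k l _ kl|k hk]; first by nia.
  have h1 : (start phi1 <= l2 * k)%N by nia.
  split=> //; have := E1 _ h1; have := phiE k; rewrite mulnA; lia.
- exists (fun k => l1 * k)%N; split=> [k l _ kl|k hk]; first by nia.
  have h2 : (start phi2 <= l1 * k)%N by nia.
  split=> //; have := E2 _ h2; have := phiE k.
  by rewrite mulnA (mulnC l2); lia.
Qed.

Definition Phi_ (alpha : int) : interlocked_family :=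
  InterlockedFamily (linear_paths_interlocked alpha).

Definition unity_roots (K : fieldType) (n : nat) : set K :=
  [set z | z ^+ n = 1].

Definition arc_mean (K : fieldType) (p : nat) (a b : K) (f : K -> K)
    (phi : path_sequence) (k : nat) : K :=
  p%:R ^- phi k *
  \sum_(z \in unity_roots (p ^ phi k))
    (let x := a + (b - a) * z in (x - a) * f x).

Definition has_arc_integral (R : realType) (K : fieldType) (v : K -> R)
    (p : nat) (a b : K) (Phi : interlocked_family) (f : K -> K) (L : K) : Prop :=
  forall e : R, 0 < e -> exists phi (N : nat),
    [/\ family Phi phi, (start phi <= N)%N
      & forall k, (N < k)%N -> v (arc_mean p a b f phi k - L) < e].

(* Main.v *)
Require Import Defs.
From mathcomp Require Import sequences cyclic separable cyclotomic ring zify.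

(** After an affine change of variables, a = a1 = 0 and b = b1 = 1, and one
    compares the mean of z f(z) over the p^n-th roots of unity z with that of
    z f(x(z)) x'(z). A power series with coefficients of size at most M has a
    mean of size at most M, because the mean of z^j is 0 or 1; hence both means
    are bounded by the sup norm of f on the open disc around 1, despite the
    factor p^-n. By uniform approximation and partial fractions it is then
    enough to treat polynomials, for which both means tend to 0, and 1/(x - c)
    with c outside the open disc. If |c| > 1 this is a limit of polynomials.
    Otherwise the first mean is 1/(1 - c^(p^n)), which is Cauchy along
    n = alpha + lambda k as soon as c^(p^lambda) = c in the residue field, and
    such a lambda exists because that field is algebraic over F_p. For the second
    mean, let tau be the preimage of c. Since x is injective, its linear
    coefficient strictly dominates, so x(t) - c = (t - tau) u(t) with u invertible on
    the closed disc; then x'/(x - c) = 1/(t - tau) + u'/u, the last term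
    contributes 0 in the limit, and tau = c in the residue field.

    That the linear coefficient dominates comes from the existence of zeros:
    otherwise, for every tau, the difference quotient (x(t) - x(tau))/(t - tau)
    has a zero in the closed disc (a limit of roots of its truncations), which
    by injectivity is tau itself, so that x' vanishes identically. *)

Set Implicit Arguments.
Unset Strict Implicit.
Unset Printing Implicit Defensive.

Local Open Scope classical_set_scope.
Local Open Scope ring_scope.

(** * Non-archimedean absolute values and the Gauss norm *)

(** Pointwise estimates on a mean lose the factor p^-n. They become harmless once n is fixed: the
    error at the finitely many roots of unity can then be taken far below |p|^n, so only the Gauss
    norm of the approximating polynomial survives. Such polynomials exist because |z - 1|^(p^n) <=
    |p| for every p^n-th root of unity z: these points stay in a closed disc of radius < 1, where
    1/(1 - y/c) with |c| >= 1 is the sum of its geometric series, whose partial sums have Gauss norm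
    1 whatever their length.

    The rate lambda depends on the pole, hence on the precision. Rates are combined by
    multiplication, and limits found at different precisions are compared along a common multiple of
    their rates.

    Poles of higher order get no formula of their own: moving one of two equal poles slightly is a
    uniform perturbation on the open disc.

    Zeros are located without Newton polygons, by expanding products of linear factors. The same
    limit of roots also shows that the completion is algebraically closed. *)

Section AbsoluteValue.
Context {R : realType} {K : fieldType} {v : K -> R} (vA : nonarch_abs v).
Implicit Types (x y : K) (e : R).

Lemma nav_ge0 x : 0 <= v x. Proof. by case: vA. Qed.

Lemma nav_eq0 x : (v x == 0) = (x == 0).
Proof. by case: vA => _ h _ _; apply/eqP/eqP => /h. Qed.

Lemma nav0 : v 0 = 0. Proof. by apply/eqP; rewrite nav_eq0. Qed.

Lemma nav_gt0 x : (0 < v x) = (x != 0).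
Proof. by rewrite lt0r nav_eq0 nav_ge0 andbT. Qed.

Lemma navM x y : v (x * y) = v x * v y. Proof. by case: vA. Qed.

Lemma nav1 : v 1 = 1.
Proof.
have /mulfI : v 1 != 0 by rewrite nav_eq0 oner_eq0.
by apply; rewrite -navM !mulr1.
Qed.

Lemma navX x n : v (x ^+ n) = v x ^+ n.
Proof. by elim: n => [|n IH]; rewrite ?expr0 ?nav1 // !exprS navM IH. Qed.

Lemma navV x : v x^-1 = (v x)^-1.
Proof.
have [->|x0] := eqVneq x 0; first by rewrite invr0 nav0 invr0.
have vx0 : v x != 0 by rewrite nav_eq0.
by apply: (mulfI vx0); rewrite -navM !mulfV // nav1.
Qed.

Lemma navN x : v (- x) = v x.
Proof.
have h : v (-1) ^+ 2 = 1 by rewrite -navX sqrrN expr1n nav1.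
have h1 : v (-1) = 1 by apply/eqP; rewrite -(@eqrXn2 _ 2) ?nav_ge0 // h expr1n.
by rewrite -mulN1r navM h1 mul1r.
Qed.

Lemma navBC x y : v (x - y) = v (y - x).
Proof. by rewrite -navN opprB. Qed.

Lemma navD_le e x y : v x <= e -> v y <= e -> v (x + y) <= e.
Proof.
by case: vA => _ _ _ h hx hy; apply: le_trans (h _ _) _; rewrite ge_max hx.
Qed.

Lemma navD_lt e x y : v x < e -> v y < e -> v (x + y) < e.
Proof.
by case: vA => _ _ _ h hx hy; apply: le_lt_trans (h _ _) _; rewrite gt_max hx.
Qed.

Lemma navB_le e x y : v x <= e -> v y <= e -> v (x - y) <= e.
Proof. by move=> hx hy; apply: navD_le; rewrite ?navN. Qed.

Lemma navB_lt e x y : v x < e -> v y < e -> v (x - y) < e.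
Proof. by move=> hx hy; apply: navD_lt; rewrite ?navN. Qed.

Lemma navDr x y : v y < v x -> v (x + y) = v x.
Proof.
move=> h; apply/eqP; rewrite eq_le; apply/andP; split.
  by apply: navD_le => //; apply: ltW.
rewrite leNgt; apply/negP => h2.
by have := navB_lt h2 h; rewrite addrK ltxx.
Qed.

Lemma nav_eq_of_dist x y : v (x - y) < v y -> v x = v y.
Proof. by move=> h; rewrite -[x](subrK y) addrC navDr. Qed.

Lemma nav_trans_le e y x z : v (x - y) <= e -> v (y - z) <= e -> v (x - z) <= e.
Proof. by move=> h1 h2; rewrite -(subrKA y) navD_le. Qed.

Lemma nav_trans_lt e y x z : v (x - y) < e -> v (y - z) < e -> v (x - z) < e.
Proof. by move=> h1 h2; rewrite -(subrKA y) navD_lt. Qed.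

Lemma nav_sum (I : Type) (s : seq I) (P : pred I) (F : I -> K) e :
  0 <= e -> (forall i, P i -> v (F i) <= e) -> v (\sum_(i <- s | P i) F i) <= e.
Proof.
move=> e0 h; elim/big_ind: _ => //; first by rewrite nav0.
by move=> x y; apply: navD_le.
Qed.

Lemma nav_nat n : v n%:R <= 1.
Proof.
elim: n => [|n IH]; first by rewrite nav0.
by rewrite -natr1 navD_le ?nav1.
Qed.

Lemma nav_prod_le1 (I : Type) (s : seq I) (P : pred I) (F : I -> K) :
  (forall i, P i -> v (F i) <= 1) -> v (\prod_(i <- s | P i) F i) <= 1.
Proof.
move=> h; elim/big_ind: _ => //; first by rewrite nav1.
by move=> x y hx hy; rewrite navM mulr_ile1 ?nav_ge0.
Qed.

Lemma navM_le1 x y : v x <= 1 -> v y <= 1 -> v (x * y) <= 1.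
Proof. by move=> hx hy; rewrite navM mulr_ile1 ?nav_ge0. Qed.

Lemma navX_le1 x n : v x <= 1 -> v (x ^+ n) <= 1.
Proof. by move=> hx; rewrite navX exprn_ile1 ?nav_ge0. Qed.

Lemma nav_small_eq0 x : (forall e, 0 < e -> v x <= e) -> x = 0.
Proof.
move=> h; apply/eqP; rewrite -nav_eq0 eq_le nav_ge0 andbT.
by apply/ler_addgt0Pl => e /h; rewrite addr0.
Qed.

Lemma nav_mulBB_le e x y x' y' : v x <= 1 -> v y' <= 1 ->
  v (x - x') <= e -> v (y - y') <= e -> v (x * y - x' * y') <= e.
Proof.
move=> hx hy hxx hyy.
have -> : x * y - x' * y' = x * (y - y') + (x - x') * y' by ring.
apply: navD_le; rewrite navM.
  by apply: le_trans hyy; rewrite ler_piMl ?nav_ge0.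
by apply: le_trans hxx; rewrite ler_piMr ?nav_ge0.
Qed.

End AbsoluteValue.

Section RealPowers.
Context {R : realType}.

Lemma geometric_small (q : R) : 0 <= q -> q < 1 ->
  forall e, 0 < e -> exists N : nat, forall n, (N <= n)%N -> q ^+ n <= e.
Proof.
move=> q0 q1 e e0.
have [N _ h] : \forall n \near \oo, q ^+ n < e.
  have := @cvg_expr R q; rewrite ger0_norm // => /(_ q1).
  move/cvgrPdist_lt => /(_ e e0); apply: filterS => n.
  by rewrite sub0r normrN ger0_norm ?exprn_ge0.
by exists N => n /h /ltW.
Qed.

End RealPowers.

Section GaussNorm.
Context {R : realType} {K : fieldType} {v : K -> R} (vA : nonarch_abs v).
Implicit Types (x y t : K) (e : R) (P Q W : {poly K}).

(** A bound on the Gauss norm, stated as a relation so that no maximum has to be computed and one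
    bound can serve a whole sequence of polynomials. *)
Definition gauss_le e P := forall i, v P`_i <= e.

Lemma gauss_le_ge0 e P : gauss_le e P -> 0 <= e.
Proof. by move=> /(_ 0%N); apply: le_trans; apply: nav_ge0. Qed.

Lemma gauss_leW e e' P : e <= e' -> gauss_le e P -> gauss_le e' P.
Proof. by move=> h hP i; apply: le_trans h. Qed.

Lemma gauss_le0 e : 0 <= e -> gauss_le e 0.
Proof. by move=> h i; rewrite coef0 nav0. Qed.

Lemma gauss_leC e x : v x <= e -> gauss_le e x%:P.
Proof.
move=> h i; rewrite coefC; case: eqP => // _; rewrite nav0 //.
exact: le_trans (nav_ge0 vA _) h.
Qed.

Lemma gauss_leXn n : gauss_le 1 'X^n.
Proof. by move=> i; rewrite coefXn nav_nat. Qed.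

Lemma gauss_leX : gauss_le 1 'X.
Proof. exact: (gauss_leXn 1). Qed.

Lemma gauss_leD e P Q : gauss_le e P -> gauss_le e Q -> gauss_le e (P + Q).
Proof. by move=> hP hQ i; rewrite coefD navD_le. Qed.

Lemma gauss_leN e P : gauss_le e P -> gauss_le e (- P).
Proof. by move=> hP i; rewrite coefN navN. Qed.

Lemma gauss_leB e P Q : gauss_le e P -> gauss_le e Q -> gauss_le e (P - Q).
Proof. by move=> hP hQ; apply: gauss_leD => //; apply: gauss_leN. Qed.

Lemma gauss_le_trans e P Q W :
  gauss_le e (P - Q) -> gauss_le e (Q - W) -> gauss_le e (P - W).
Proof. by move=> h1 h2; rewrite -(subrKA Q); apply: gauss_leD. Qed.

Lemma gauss_leBC e P Q : gauss_le e (P - Q) -> gauss_le e (Q - P).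
Proof. by move=> h; rewrite -opprB; apply: gauss_leN. Qed.

Lemma gauss_leM e e' P Q : gauss_le e P -> gauss_le e' Q ->
  gauss_le (e * e') (P * Q).
Proof.
move=> hP hQ i; rewrite coefM; apply: (nav_sum vA).
  by rewrite mulr_ge0 ?(gauss_le_ge0 hP) ?(gauss_le_ge0 hQ).
by move=> j _; rewrite navM // ler_pM ?nav_ge0.
Qed.

Lemma gauss_leZ e x P : v x <= 1 -> gauss_le e P -> gauss_le e (x *: P).
Proof.
by move=> hx hP i; rewrite coefZ navM //; apply: le_trans (hP i);
  rewrite ler_piMl ?nav_ge0.
Qed.

Lemma gauss_leX_exp P n : gauss_le 1 P -> gauss_le 1 (P ^+ n).
Proof.
move=> hP; elim: n => [|n IH]; first by apply: gauss_leC; rewrite nav1.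
by rewrite exprS -[1]mulr1; apply: gauss_leM.
Qed.

Lemma gauss_leXn_exp e P n : gauss_le e P -> gauss_le (e ^+ n) (P ^+ n).
Proof.
move=> hP; elim: n => [|n IH]; first by apply: gauss_leC; rewrite nav1.
by rewrite !exprS; apply: gauss_leM.
Qed.

Lemma gauss_le_sum (I : Type) (s : seq I) (A : pred I) (F : I -> {poly K}) e :
  0 <= e -> (forall i, A i -> gauss_le e (F i)) ->
  gauss_le e (\sum_(i <- s | A i) F i).
Proof. by move=> e0 h i; rewrite coef_sum; apply: (nav_sum vA) => // j /h. Qed.

Lemma gauss_le_deriv e P : gauss_le e P -> gauss_le e P^`().
Proof.
move=> hP i; rewrite coef_deriv -mulr_natl navM //.
by apply: le_trans (hP i.+1); rewrite ler_piMl ?nav_ge0 ?nav_nat.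
Qed.

Lemma gauss_le_horner e P t : gauss_le e P -> v t <= 1 -> v P.[t] <= e.
Proof.
move=> hP ht; rewrite horner_coef; apply: (nav_sum vA).
  exact: gauss_le_ge0 hP.
move=> i _; rewrite navM // navX //; apply: le_trans (hP i).
by rewrite ler_piMr ?nav_ge0 // exprn_ile1 ?nav_ge0.
Qed.

Lemma gauss_le_comp e P Q : gauss_le e P -> gauss_le 1 Q -> gauss_le e (P \Po Q).
Proof.
move=> hP hQ; rewrite comp_polyE; apply: gauss_le_sum => [|i _].
  exact: gauss_le_ge0 hP.
rewrite -mul_polyC -[e]mulr1; apply: gauss_leM; first exact: gauss_leC.
exact: gauss_leX_exp.
Qed.

Lemma gauss_le_expB e P Q n : gauss_le 1 P -> gauss_le 1 Q ->
  gauss_le e (P - Q) -> gauss_le e (P ^+ n - Q ^+ n).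
Proof.
move=> hP hQ h; rewrite subrXX -[e]mulr1; apply: gauss_leM => //.
apply: gauss_le_sum => // i _; rewrite -[1]mulr1.
by apply: gauss_leM; apply: gauss_leX_exp.
Qed.

Lemma gauss_le_compB e e' H P Q : gauss_le 1 P -> gauss_le 1 Q ->
  gauss_le e' H -> gauss_le e (P - Q) -> gauss_le (e' * e) ((H \Po P) - (H \Po Q)).
Proof.
move=> hP hQ hH h.
rewrite !comp_polyE -sumrB; apply: gauss_le_sum => [|i _].
  by rewrite mulr_ge0 ?(gauss_le_ge0 hH) ?(gauss_le_ge0 h).
rewrite -scalerBr -mul_polyC; apply: gauss_leM; first exact: gauss_leC.
exact: gauss_le_expB.
Qed.

Lemma gauss_le_ex P : exists2 e, 0 < e & gauss_le e P.
Proof.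
elim/poly_ind: P => [|P c [e e0 hP]]; first by exists 1 => //; apply: gauss_le0.
exists (Num.max e (v c)); first by rewrite lt_max e0.
apply: gauss_leD; last by apply: gauss_leC; rewrite le_max lexx orbT.
apply: (@gauss_leW e); first by rewrite le_max lexx.
by rewrite -[e]mulr1; apply: gauss_leM => //; apply: gauss_leX.
Qed.

Lemma horner_lipschitz e P x y : gauss_le e P -> v x <= 1 -> v y <= 1 ->
  v (P.[x] - P.[y]) <= e * v (x - y).
Proof.
move=> hP hx hy; have e0 := gauss_le_ge0 hP.
rewrite !horner_coef -sumrB; apply: (nav_sum vA).
  by rewrite mulr_ge0 ?nav_ge0.
move=> i _; rewrite -mulrBr navM // ler_pM ?nav_ge0 ?hP //.
rewrite subrXX navM // ler_piMr ?nav_ge0 //.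
apply: (nav_sum vA) => // j _.
by apply: navM_le1 => //; apply: navX_le1.
Qed.

(* Synthetic division by [X - t] does not increase the Gauss norm. *)
Lemma gauss_le_divX e (m : nat) P U t : v t <= 1 -> 0 <= e ->
  P = U * ('X - t%:P) -> (forall i, (m < i)%N -> v P`_i <= e) ->
  forall i, (m <= i)%N -> v U`_i <= e.
Proof.
move=> ht e0 PE hP i mi.
(* This recursion is run downwards from the degree of [U]. It reads only the coefficients of [P]
   above the index reached, which is why the threshold [m] suffices and the constant term of [P] is
   irrelevant when [m = 0]. *)
have coefU j : U`_j = P`_j.+1 + U`_j.+1 * t.
  by rewrite PE mulrBr coefB coefMX coefMC subrK.
have [n] := ubnP (size U - i)%N; elim: n i mi => // n IH i mi hn.
have [h|h] := leqP (size U) i; first by rewrite nth_default ?nav0.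
rewrite coefU; apply: navD_le => //; first by apply: hP; rewrite ltnS.
rewrite navM //; apply: (@le_trans _ _ (v U`_i.+1)).
  by rewrite ler_piMr ?nav_ge0.
apply: IH; first exact: leqW.
by rewrite -ltnS; apply: leq_trans hn; rewrite ltnS ltn_sub2l.
Qed.

End GaussNorm.

Arguments gauss_le {R K} v e P.

(** * Roots of split polynomials *)

Section Roots.
Context {R : realType} {K : fieldType} {v : K -> R} (vA : nonarch_abs v).
Implicit Types (x y t r c : K) (e h : R) (P Q W : {poly K}) (s : seq K).

Definition splits W := exists s, W = lead_coef W *: \prod_(r <- s) ('X - r%:P).

Lemma root_splits W s r : W != 0 ->
  W = lead_coef W *: \prod_(z <- s) ('X - z%:P) -> root W r = (r \in s).
Proof.
move=> W0 {1}->; rewrite rootZ ?lead_coef_eq0 // root_prod_XsubC //.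
Qed.

(** Multiplying by X - r with |r| > h preserves strict dominance of the constant term at radius h.
    It is used by contraposition: a higher term that is not smaller than the constant one forces a
    root of size at most h. *)
Lemma prod_roots_dominant s h : 0 <= h -> (forall r, r \in s -> h < v r) ->
  let Q := \prod_(r <- s) ('X - r%:P) in
  0 < v Q`_0 /\ forall i, (0 < i)%N -> v Q`_i * h ^+ i < v Q`_0.
Proof.
move=> h0; elim: s => [|r s IH] hs /=.
  rewrite big_nil coef1 nav1 //; split=> // i i0.
  by rewrite coef1 -[i]prednK //= nav0 // mul0r ltr01.
have [|Q0 hQ] := IH; first by move=> z zs; apply: hs; rewrite inE zs orbT.
have hr : h < v r by apply: hs; rewrite inE eqxx.
have r0 : 0 < v r by apply: le_lt_trans hr.
rewrite big_cons; set Q := \prod_(_ <- s) _ in Q0 hQ *.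
have E0 : v (('X - r%:P) * Q)`_0 = v r * v Q`_0.
  by rewrite mulrBl coefB coefXM coefCM /= sub0r navN // navM.
split=> [|[//|i] _]; first by rewrite E0 mulr_gt0.
rewrite E0 mulrBl coefB coefXM coefCM /=.
have hi : 0 <= h ^+ i.+1 by rewrite exprn_ge0.
have key x y : v x * h ^+ i.+1 < v r * v Q`_0 ->
    v y * h ^+ i.+1 < v r * v Q`_0 -> v (x - y) * h ^+ i.+1 < v r * v Q`_0.
  move=> hx hy; have [xy|/ltW xy] := leP (v x) (v y).
    by apply: le_lt_trans hy; rewrite ler_wpM2r // navB_le.
  by apply: le_lt_trans hx; rewrite ler_wpM2r // navB_le.
apply: key; last first.
  by rewrite navM // -mulrA ltr_pM2l // hQ.
case: i {hi} => [|i]; first by rewrite expr1 mulrC ltr_pM2r.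
rewrite exprSr mulrA [ltRHS]mulrC.
apply: (@le_lt_trans _ _ (v Q`_0 * h)); last by rewrite ltr_pM2l.
by rewrite ler_wpM2r // ltW // hQ.
Qed.

Lemma nav_sum_lt (I : Type) (s : seq I) (A : pred I) (F : I -> K) e :
  0 < e -> (forall i, A i -> v (F i) < e) -> v (\sum_(i <- s | A i) F i) < e.
Proof.
move=> e0 H; elim/big_ind: _ => //; first by rewrite nav0.
by move=> x y; apply: navD_lt.
Qed.

(** Terms of degree below [d] do not reach the coefficient [d], and those above contribute less than
    1: the translation acts as on a polynomial of degree [d]. *)
Lemma shift_coef W d t : v t <= 1 -> v W`_d = 1 ->
  (forall i, (d < i)%N -> v W`_i < 1) -> v (W \Po ('X + t%:P))`_d = 1.
Proof.
move=> ht hd hlt.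
have -> : 'X + t%:P = 'X - (- t)%:P :> {poly K} by rewrite polyCN opprK.
have sd : (d < size W)%N.
  rewrite ltnNge; apply/negP => /leq_sizeP/(_ d (leqnn _)) E.
  by move: hd; rewrite E nav0 // => /eqP; rewrite eq_sym oner_eq0.
rewrite coef_comp_poly (bigD1 (Ordinal sd)) //=.
have -> : (('X - (- t)%:P) ^+ d : {poly K})`_d = 1.
  have /monicP : ('X - (- t)%:P : {poly K}) ^+ d \is monic.
    by rewrite rpredX ?monicXsubC.
  by rewrite lead_coefE size_exp_XsubC.
rewrite mulr1; apply: (eq_trans _ hd); apply: navDr => //; rewrite hd.
apply: nav_sum_lt => // i; rewrite -val_eqE /= neq_ltn => /orP[id|id].
  by rewrite [X in _ * X]nth_default ?mulr0 ?nav0 // size_exp_XsubC.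
rewrite navM //; apply: le_lt_trans (hlt _ id).
rewrite ler_piMr ?nav_ge0 //.
have : gauss_le v 1 (('X - (- t)%:P) ^+ i).
  apply: gauss_leX_exp => //; apply: gauss_leB => //; first exact: gauss_leX.
  by apply: gauss_leC; rewrite ?navN.
exact.
Qed.

Lemma comp_splits W s t : W = lead_coef W *: \prod_(r <- s) ('X - r%:P) ->
  W \Po ('X + t%:P) = lead_coef W *: \prod_(r <- [seq x - t | x <- s]) ('X - r%:P).
Proof.
move=> {1}->; rewrite comp_polyZ; congr (_ *: _).
rewrite rmorph_prod big_map; apply: eq_bigr => r _ /=.
by rewrite comp_polyB comp_polyX comp_polyC polyCB opprB addrA addrAC.
Qed.

Lemma splits_root_le1 W d : (0 < d)%N -> splits W -> gauss_le v 1 W ->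
  v W`_d = 1 -> exists2 r, root W r & v r <= 1.
Proof.
move=> d0 [s sW] hW hd.
have W0 : W != 0.
  by apply/eqP => E; move: hd; rewrite E coef0 nav0 // => /eqP; rewrite eq_sym oner_eq0.
apply: contrapT => H.
have hs r : r \in s -> 1 < v r.
  move=> rs; rewrite ltNge; apply/negP => r1; apply: H; exists r => //.
  by rewrite (root_splits _ W0 sW).
have [_ /(_ d d0)] := prod_roots_dominant ler01 hs.
rewrite expr1n mulr1 => h1.
have l0 : 0 < v (lead_coef W) by rewrite nav_gt0 // lead_coef_eq0.
have : v W`_d < v W`_0 by rewrite sW !coefZ !navM // ltr_pM2l.
by rewrite hd ltNge hW.
Qed.

(** After translating t to 0 the constant coefficient is W(t), of size at most h^d, while the
    coefficient of degree d is still a unit. If all roots were farther than h from t, the constant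
    term would dominate strictly. *)
Lemma splits_root_near W d t h : (0 < d)%N -> splits W -> v W`_d = 1 ->
  (forall i, (d < i)%N -> v W`_i < 1) -> v t <= 1 -> 0 <= h ->
  v W.[t] <= h ^+ d -> exists2 r, root W r & v (r - t) <= h.
Proof.
move=> d0 [s sW] hd hi ht h0 hW.
have W0 : W != 0.
  by apply/eqP => E; move: hd; rewrite E coef0 nav0 // => /eqP; rewrite eq_sym oner_eq0.
apply: contrapT => H.
have hs r : r \in [seq x - t | x <- s] -> h < v r.
  case/mapP => x xs ->; rewrite ltNge; apply/negP => x1; apply: H.
  by exists x => //; rewrite (root_splits _ W0 sW).
have [_ /(_ d d0)] := prod_roots_dominant h0 hs.
have l0 : 0 < v (lead_coef W) by rewrite nav_gt0 // lead_coef_eq0.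
rewrite -(ltr_pM2l l0) mulrA -!navM // -!coefZ -(comp_splits _ sW).
rewrite shift_coef // mul1r -horner_coef0 horner_comp !hornerE => h1.
by move: (lt_le_trans h1 hW); rewrite ltxx.
Qed.

End Roots.

(** * Frobenius congruences and limits of roots *)

Section PrimePowers.
Context {R : realType} {K : fieldType} {v : K -> R} (vA : nonarch_abs v).
Context {p : nat} (p_prime : prime p).
Implicit Types (x y : K) (e : R).

Lemma nav_subX x y n : v x <= 1 -> v y <= 1 -> v (x ^+ n - y ^+ n) <= v (x - y).
Proof.
move=> hx hy; rewrite subrXX navM // ler_piMr ?nav_ge0 //.
apply: (nav_sum vA) => // i _.
by apply: navM_le1 => //; apply: navX_le1.
Qed.

Lemma nav_frobenius x y : v x <= 1 -> v y <= 1 ->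
  v (x ^+ p - y ^+ p - (x - y) ^+ p) <= v p%:R.
Proof.
move=> hx hy; have p0 := prime_gt0 p_prime.
set z := x - y; have hz : v z <= 1 by apply: navB_le.
have -> : x = y + z by rewrite addrC subrK.
have binom n : (y + z) ^+ n.+1 = y ^+ n.+1 +
    (\sum_(i < n) y ^+ (n - i) * z ^+ i.+1 *+ 'C(n.+1, i.+1) + z ^+ n.+1).
  rewrite exprDn big_ord_recl big_ord_recr /= subn0 subnn bin0 binn.
  by rewrite !expr0 mulr1 mul1r !mulr1n.
rewrite -(prednK p0) binom prednK //.
set S := \sum_(i < _) _.
have -> : y ^+ p + (S + z ^+ p) - y ^+ p - z ^+ p = S.
  by ring.
apply: (nav_sum vA) => [|i _]; first exact: nav_ge0.
have ip : (0 < i.+1 < p)%N by have := ltn_ord i; lia.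
have /dvdnP[c ->] := prime_dvd_bin p_prime ip.
rewrite -mulr_natl natrM -mulrA mulrCA navM // ler_piMr ?nav_ge0 //.
apply: navM_le1 => //; first exact: nav_nat.
by apply: navM_le1 => //; apply: navX_le1.
Qed.

Lemma nav_frobenius_iter x y n : v x <= 1 -> v y <= 1 ->
  v (x ^+ (p ^ n) - y ^+ (p ^ n) - (x - y) ^+ (p ^ n)) <= v p%:R.
Proof.
move=> hx hy; have h1 m z : v z <= 1 -> v (z ^+ m) <= 1 by apply: navX_le1.
elim: n => [|n IH]; first by rewrite expn0 !expr1 subrr nav0 ?nav_ge0.
rewrite expnSr !exprM.
have hA := h1 (p ^ n)%N _ hx; have hB := h1 (p ^ n)%N _ hy.
have := nav_frobenius hA hB.
set A := x ^+ _ in hA IH *; set B := y ^+ _ in hB IH *; set D := (x - y) ^+ _.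
move=> h; apply: (nav_trans_le vA h).
apply: (le_trans _ IH); apply: (nav_subX (y := D) _ (navB_le vA hA hB)).
by apply: h1; apply: navB_le.
Qed.

Lemma nav_expX_lt1 x n : v (x ^+ n) < 1 -> v x < 1.
Proof.
move=> h; rewrite ltNge; apply/negP => h1; move: h.
by rewrite navX // ltNge exprn_ege1.
Qed.

(** The cofactor of x - y in x^p - y^p is congruent to p y^(p-1) modulo x - y, so its size is at
    most e. *)
Lemma nav_contract x y e : v x <= 1 -> v y <= 1 -> v (x - y) <= e ->
  v p%:R <= e -> v (x ^+ p - y ^+ p) <= e * v (x - y).
Proof.
move=> hx hy h hp; rewrite subrXX navM // mulrC ler_wpM2r ?nav_ge0 //.
have -> : \sum_(i < p) x ^+ (p.-1 - i) * y ^+ i =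
    \sum_(i < p) (x ^+ (p.-1 - i) - y ^+ (p.-1 - i)) * y ^+ i + p%:R * y ^+ p.-1.
  rewrite mulr_natl -[p in _ *+ p]card_ord -sumr_const -big_split /=.
  apply: eq_bigr => i _; rewrite mulrBl -exprD subnK ?subrK //.
  by rewrite -ltnS prednK // (leq_trans _ (ltn_ord i)).
have hyi i : v (y ^+ i) <= 1 by apply: navX_le1.
apply: navD_le => //.
  apply: (nav_sum vA) => [|i _]; first exact: le_trans (nav_ge0 vA _) h.
  rewrite navM //; apply: (le_trans _ h).
  apply: (le_trans _ (nav_subX (p.-1 - i) hx hy)).
  by rewrite ler_piMr ?nav_ge0.
by rewrite navM //; apply: (le_trans _ hp); rewrite ler_piMr ?nav_ge0.
Qed.

(** For e < 1 the bound tends to 0: asymptotically, x^(p^n) depends only on the residue class of x.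
    Both the Cauchy property of the pole means and the comparison of a pole with its preimage rest
    on this. *)
Lemma nav_contract_iter x y e n : v x <= 1 -> v y <= 1 -> v (x - y) <= e ->
  v p%:R <= e -> e <= 1 -> v (x ^+ (p ^ n) - y ^+ (p ^ n)) <= e ^+ n.+1.
Proof.
move=> hx hy h hp e1; have e0 : 0 <= e by apply: le_trans (nav_ge0 vA _) h.
have h1 m z : v z <= 1 -> v (z ^+ m) <= 1 by apply: navX_le1.
elim: n => [|n IH]; first by rewrite expn0 !expr1.
rewrite expnSr !exprM.
apply: (le_trans (nav_contract (h1 _ _ hx) (h1 _ _ hy) (le_trans IH _) hp)).
  by rewrite exprS ler_piMr // exprn_ile1.
by rewrite exprS ler_wpM2l.
Qed.

End PrimePowers.

(** * Limits in a complete field and limits of roots *)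

Section Completeness.
Context {R : realType} {K : fieldType} {v : K -> R} (vA : nonarch_abs v).
Implicit Types (x y l : K) (e : R) (u : nat -> K).

Lemma vcvgP u l : vcvg v u l <->
  forall e, 0 < e -> exists N : nat, forall n, (N <= n)%N -> v (u n - l) <= e.
Proof.
split=> [/cvgrPdist_lt h e e0|h].
  have [N _ hN] := h e e0; exists N => n /hN.
  by rewrite sub0r normrN ger0_norm ?nav_ge0 // => /ltW.
apply/cvgrPdist_lt => e e0; have e2 : 0 < e / 2 by rewrite divr_gt0.
have [N hN] := h _ e2; exists N => // n /= /hN hn.
rewrite sub0r normrN ger0_norm ?nav_ge0 //; apply: le_lt_trans hn _.
by rewrite ltr_pdivrMr // ltr_pMr // ltr1n.
Qed.

Lemma vcvg_unique u l l' : vcvg v u l -> vcvg v u l' -> l = l'.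
Proof.
move=> /vcvgP h /vcvgP h'; apply/eqP; rewrite -subr_eq0; apply/eqP.
apply: (nav_small_eq0 vA) => e e0; have [N hN] := h e e0; have [N' hN'] := h' e e0.
apply: (@nav_trans_le _ _ v vA e (u (maxn N N'))).
  by rewrite navBC // hN ?leq_maxl.
by rewrite hN' ?leq_maxr.
Qed.

Lemma vcvg_le u l e : vcvg v u l -> (forall n, v (u n) <= e) -> v l <= e.
Proof.
move=> /vcvgP h hu; apply/ler_addgt0Pl => d d0; have [N hN] := h d d0.
have e0 : 0 <= e := le_trans (nav_ge0 vA _) (hu 0%N).
rewrite -(subKr (u N) l); apply: navB_le => //.
  by apply: le_trans (hu N) _; rewrite lerDr ltW.
by apply: le_trans (hN N _) _ => //; rewrite lerDl.
Qed.

Context (v_complete : vcomplete v).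

Lemma vcvg_of_cauchy_le u :
  (forall e, 0 < e -> exists N : nat, forall m n, (N <= m)%N -> (N <= n)%N ->
     v (u m - u n) <= e) ->
  exists l, vcvg v u l.
Proof.
move=> h; apply: v_complete => e e0.
have e2 : 0 < e / 2 by rewrite divr_gt0.
have [N hN] := h _ e2; exists N => m n hm hn; apply: le_lt_trans (hN _ _ hm hn) _.
by rewrite ltr_pdivrMr // ltr_pMr // ltr1n.
Qed.

Let half n : R := 2^-1 ^+ n.

Lemma half_gt0 n : 0 < half n. Proof. by rewrite exprn_gt0 // invr_gt0. Qed.

Lemma half_le n m : (n <= m)%N -> half m <= half n.
Proof.
move=> nm; rewrite -(subnK nm) /half exprD ler_piMl ?exprn_ge0 ?invr_ge0 //.
by rewrite exprn_ile1 ?invr_ge0 ?invf_le1 ?ler1n.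
Qed.

Lemma half_small e : 0 < e -> exists N, half N <= e.
Proof.
move=> e0; have [||N hN] := @geometric_small R 2^-1 _ _ e e0.
- by rewrite invr_ge0.
- by rewrite invf_lt1 // ltr1n.
- by exists N; apply: hN.
Qed.

(** A root r of W_n satisfies |W_(n+1)(r)| <= (2^-n)^d, so W_(n+1) has a root within 2^-n of r; the
    exponent d pays for the d-th root taken in [splits_root_near]. The roots chosen in this way form
    a Cauchy sequence. *)
Lemma limit_root (W : nat -> {poly K}) d : (0 < d)%N ->
  (forall n, splits (W n)) -> (forall n, gauss_le v 1 (W n)) ->
  (forall n, v (W n)`_d = 1) ->
  (forall n i, (d < i)%N -> v (W n)`_i < 1) ->
  (forall n, gauss_le v (half n ^+ d) (W n.+1 - W n)) ->
  exists2 r, v r <= 1 &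
    forall e, 0 < e -> exists N : nat, forall n, (N <= n)%N -> v (W n).[r] <= e.
Proof.
move=> d0 hs h1 hd hi hW.
have hd1 n : half n ^+ d <= half n.
  have hn : half n <= 1 by rewrite /half exprn_ile1 ?invr_ge0 ?invf_le1 ?ler1n.
  have hn0 : 0 <= half n := ltW (half_gt0 n).
  by rewrite -(prednK d0) exprS ler_piMr // exprn_ile1.
(* The hypotheses stand under the existential so that [choice] yields a total function; 0 is the
   default away from the integral roots. *)
have step (nr : nat * K) : exists r', root (W nr.1) nr.2 -> v nr.2 <= 1 ->
    [/\ root (W nr.1.+1) r', v r' <= 1 & v (r' - nr.2) <= half nr.1].
  case: nr => n r /=; have [[rr r1]|H] := pselect (root (W n) r /\ v r <= 1).
    have [|r' h h'] :=
        splits_root_near vA d0 (hs n.+1) (hd n.+1) (hi n.+1) r1 (ltW (half_gt0 n)).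
      have -> : (W n.+1).[r] = (W n.+1 - W n).[r].
        by rewrite hornerD hornerN (rootP rr) subr0.
      exact: (gauss_le_horner vA (hW n)).
    exists r' => _ _; split => //; rewrite -(subrK r r') navD_le //.
    apply: le_trans h' _.
    by rewrite /half exprn_ile1 ?invr_ge0 ?invf_le1 ?ler1n.
  by exists 0 => rr r1; case: H.
have [f hf] := choice step.
have [r0 rr0 r01] := splits_root_le1 vA d0 (hs 0%N) (h1 0%N) (hd 0%N).
pose u := fix u n := if n is m.+1 then f (m, u m) else r0.
have uP n : root (W n) (u n) /\ v (u n) <= 1.
  by elim: n => [|n [IH IH']] //=; have [] := hf (n, u n) IH IH'.
have uS n : v (u n.+1 - u n) <= half n.
  by have [h h'] := uP n; have [_ _] := hf (n, u n) h h'.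
have uD n k : v (u (n + k)%N - u n) <= half n.
  elim: k => [|k IH]; first by rewrite addn0 subrr nav0 // ltW // half_gt0.
  apply: (nav_trans_le vA _ IH); rewrite addnS; apply: le_trans (uS _) _.
  by apply: half_le; rewrite leq_addr.
have WD n k : gauss_le v (half n) (W (n + k)%N - W n).
  elim: k => [|k IH]; first by rewrite addn0 subrr; apply/gauss_le0/ltW/half_gt0.
  apply: (gauss_le_trans vA _ IH); rewrite addnS; apply: gauss_leW (hW _).
  by apply: le_trans (hd1 _) _; apply: half_le; rewrite leq_addr.
have [|l hl] := @vcvg_of_cauchy_le u.
  move=> e /half_small[N hN]; exists N => m n hm hn.
  apply: le_trans hN; rewrite -(subnKC hm) -(subnKC hn).
  by apply: (nav_trans_le vA (uD _ _)); rewrite navBC.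
have l1 : v l <= 1 by apply: (vcvg_le hl) => n; case: (uP n).
exists l => // e /half_small[N hN]; exists N => n nN; apply: le_trans hN.
apply: le_trans (half_le nN).
have [M hM] := (vcvgP u l).1 hl _ (half_gt0 n).
have [rm um1] := uP (n + M)%N.
rewrite -[_.[l]](subrK (W n).[u (n + M)%N]); apply: navD_le => //.
  apply: le_trans (horner_lipschitz vA (h1 n) l1 um1) _.
  by rewrite mul1r navBC // hM ?leq_addl.
have -> : (W n).[u (n + M)%N] = (W n - W (n + M)%N).[u (n + M)%N].
  by rewrite hornerD hornerN (rootP rm) subr0.
by apply: (gauss_le_horner vA) um1; apply: gauss_leBC.
Qed.

End Completeness.

(** * Algebraic closedness of the completion *)

Lemma splits_of_roots (K : fieldType) :
  (forall P : {poly K}, (1 < size P)%N -> exists r, root P r) ->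
  forall P : {poly K}, splits P.
Proof.
move=> h P; have [n] := ubnP (size P); elim: n P => // n IH P hn.
have [P1|/h[r rP]] := leqP (size P) 1.
  exists [::]; rewrite big_nil; have := size1_polyC P1 => ->.
  by rewrite lead_coefC alg_polyC.
have [->|P0] := eqVneq P 0; first by exists [::]; rewrite lead_coef0 scale0r.
have /factor_theorem[Q PE] := rP.
have [|s sQ] := IH Q.
  have Q0 : Q != 0 by apply/eqP => E; move: P0; rewrite PE E mul0r eqxx.
  by move: hn; rewrite PE size_Mmonic ?monicXsubC // size_XsubC addn2 ltnS.
exists (r :: s); rewrite big_cons {1}PE {1}sQ PE lead_coefM lead_coefXsubC mulr1.
by rewrite -scalerAl mulrC.
Qed.

Lemma closed_field_root (K : fieldType) : GRing.closed_field_axiom K ->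
  forall P : {poly K}, (1 < size P)%N -> exists r, root P r.
Proof.
move=> h P P1; have P0 : P != 0.
  by apply/eqP => E; move: P1; rewrite E size_poly0.
have d0 : (0 < (size P).-1)%N by rewrite -ltnS prednK // ltnW.
have [r hr] := h _ (fun i => - P`_i / lead_coef P) d0; exists r.
have l0 : lead_coef P != 0 by rewrite lead_coef_eq0.
rewrite /root horner_coef -(prednK (ltnW P1)) big_ord_recr /= hr mulr_sumr.
rewrite -big_split /= big1 // => i _; rewrite -/(lead_coef P).
by field.
Qed.

Section ClosedCompletion.
Context {R : realType} {L K : fieldType} {v : K -> R} (vA : nonarch_abs v).
Context (v_complete : vcomplete v) (k : {rmorphism L -> K}).
Context (L_closed : GRing.closed_field_axiom L).
Context (k_dense : forall y (e : R), 0 < e -> exists x, v (y - k x) < e).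

(** Polynomials over the dense closed subfield split, and approximants of [P] have roots that
    converge to a root of [P]. The precision [h] carries the exponent [d] that [limit_root] asks
    for. *)
Lemma closed_completion_monic_root (P : {poly K}) d : (0 < d)%N ->
  P \is monic -> size P = d.+1 -> gauss_le v 1 P -> exists r, root P r.
Proof.
move=> d0 mP sP P1; pose h n : R := (2^-1 ^+ n) ^+ d.
have h0 n : 0 < h n by rewrite !exprn_gt0 // invr_gt0.
have h1 n : h n <= 1.
  by rewrite /h !exprn_ile1 ?exprn_ge0 ?invr_ge0 ?invf_le1 ?ler1n.
have hS n : h n.+1 <= h n.
  rewrite /h -!exprM; apply: ler_wiXn2l; rewrite ?invr_ge0 ?invf_le1 ?ler1n //.
  by rewrite leq_mul2r leqnSn orbT.
have [y yP] := choice (fun ni : nat * nat => k_dense P`_ni.2 (h0 ni.1)).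
(* The leading coefficient is kept equal to 1 instead of being approximated, so every approximant is
   monic of degree [d]. *)
pose V n := \poly_(i < d.+1) (if i == d then 1 else y (n, i)).
have sV n : size (V n) = d.+1.
  by rewrite size_poly_eq // eqxx oner_eq0.
pose W n := map_poly k (V n).
have Wi n i : v ((W n)`_i - P`_i) <= h n.
  rewrite coef_map coef_poly; case: ltnP => id /=; last first.
    by rewrite rmorph0 nth_default ?subrr ?nav0 ?ltW // sP.
  case: eqP => [->|_]; last by rewrite navBC // ltW // (yP (n, i)).
  have -> : P`_d = 1 by move/monicP: mP; rewrite lead_coefE sP.
  by rewrite rmorph1 subrr nav0 // ltW.
have Wd n : (W n)`_d = 1 by rewrite coef_map coef_poly ltnSn eqxx /= rmorph1.
have [|||||r r1 hr] := @limit_root _ _ _ vA v_complete W d d0.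
- move=> n; rewrite /splits lead_coef_map.
  have [s sE] := splits_of_roots (closed_field_root L_closed) (V n).
  exists (map k s); rewrite /W {1}sE linearZ /= rmorph_prod big_map.
  by congr (_ *: _); apply: eq_bigr => i _; rewrite rmorphB /= map_polyX map_polyC.
- move=> n i; rewrite -[_`_i](subrK P`_i); apply: navD_le => //.
  exact: le_trans (Wi _ _) (h1 n).
- by move=> n; rewrite Wd nav1.
- by move=> n i id; rewrite coef_map coef_poly ltnNge id /= rmorph0 nav0.
- move=> n i; rewrite coefB; apply: (nav_trans_le vA (y := P`_i)).
    by apply: le_trans (Wi _ _) (hS n).
  by rewrite navBC.
exists r; apply/rootP/(nav_small_eq0 vA) => e e0.
have [N hN] := hr e e0; have [||M hM] := @geometric_small R (2^-1 ^+ d) _ _ e e0.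
- by rewrite exprn_ge0 ?invr_ge0.
- by rewrite exprn_ilt1 ?invr_ge0 ?invf_lt1 ?ltr1n // -lt0n.
rewrite -[P.[r]](subKr (W (maxn N M)).[r]); apply: navB_le => //.
  by apply: hN; apply: leq_maxl.
rewrite -hornerN -hornerD; apply: (gauss_le_horner vA) r1 => i.
rewrite coefB; apply: le_trans (Wi _ _) _.
by rewrite /h exprAC hM ?leq_maxr.
Qed.

Lemma closed_completion_root (P : {poly K}) : (1 < size P)%N ->
  exists r, root P r.
Proof.
move=> P1; set d := (size P).-1; have sP : size P = d.+1 by rewrite prednK // ltnW.
have d0 : (0 < d)%N by rewrite -ltnS -sP.
pose l := lead_coef P; have l0 : l != 0.
  by rewrite lead_coef_eq0 -size_poly_gt0 ltnW.
pose Q := l^-1 *: P.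
have [c c1 hc] : exists2 c, 1 <= v c & gauss_le v (v c) Q.
  elim/poly_ind: Q => [|Q b [c c1 hc]]; first by exists 1; rewrite ?nav1 //; apply: gauss_le0.
  have hX : gauss_le v (v c) (Q * 'X).
    by rewrite -[v c]mulr1; apply: gauss_leM => //; apply: gauss_leX.
  have [bc|/ltW bc] := leP (v b) (v c).
    by exists c => //; apply: gauss_leD => //; apply: gauss_leC.
  exists b; first exact: le_trans bc.
  by apply: gauss_leD => //; [apply: gauss_leW hX | apply: gauss_leC].
have c0 : c != 0 by rewrite -(nav_gt0 vA); apply: lt_le_trans c1.
(* This is Q(cX)/c^d. It is monic, and integral because |Q_i c^i| <= |c|^(i+1) <= |c|^d for i <
   d. *)
pose T := \poly_(i < d.+1) (Q`_i * c ^+ i / c ^+ d).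
have Qd : Q`_d = 1 by rewrite coefZ -[P`_d]/l mulVf.
have Td : Q`_d * c ^+ d / c ^+ d = 1 by rewrite Qd mul1r mulfV ?expf_neq0.
have sT : size T = d.+1 by rewrite size_poly_eq // Td oner_eq0.
have [||||r rT] := @closed_completion_monic_root T d.
- by [].
- by apply/monicP; rewrite lead_coefE sT coef_poly ltnSn.
- by [].
- move=> i; rewrite coef_poly; case: ltnP => id; last by rewrite nav0.
  move: id; rewrite ltnS leq_eqVlt => /orP[/eqP->|id]; first by rewrite Td nav1.
  rewrite navM // navV // ler_pdivrMr ?nav_gt0 ?expf_neq0 // mul1r (navM vA) !(navX vA).
  apply: (le_trans _ (ler_weXn2l c1 id)).
  by rewrite exprS ler_wpM2r ?exprn_ge0 ?nav_ge0.
exists (c * r); have : root Q (c * r).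
  have sQ : size Q = d.+1 by rewrite size_scale ?invr_eq0.
  have : T.[r] * c ^+ d = Q.[c * r].
    rewrite horner_poly horner_coef sQ mulr_suml; apply: eq_bigr => i _.
    by rewrite exprMn [in LHS]mulrAC mulrVK ?mulrA // unitfE expf_neq0.
  by rewrite (rootP rT) mul0r => E; apply/rootP.
by rewrite rootZ // invr_eq0.
Qed.

End ClosedCompletion.

(** * The residue field of C_p *)

Lemma nav_int (R : realType) (K : fieldType) (v : K -> R) (vA : nonarch_abs v)
  (z : int) : v z%:~R <= 1.
Proof.
by case: z => n; rewrite ?NegzE ?mulrNz ?navN // -pmulrn nav_nat.
Qed.

Section Residue.
Context {R : realType} {p : nat} (p_prime : prime p).
Context {Qp L : fieldType} {vQ : Qp -> R} {vL : L -> R}.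
Context (i : {rmorphism rat -> Qp}) (j : {rmorphism Qp -> L}).
Context (Qp_compl : is_completion (padic_abs R p) vQ i).
Context (LA : nonarch_abs vL) (vj : forall x, vL (j x) = vQ x).

Let QA : nonarch_abs vQ. Proof. by case: Qp_compl. Qed.

Lemma padic_abs_p : padic_abs R p p%:R = p%:R^-1.
Proof.
have p0 := prime_gt0 p_prime.
have E : p%:R = p%:Z%:~R :> rat by rewrite pmulrn.
rewrite /padic_abs pnatr_eq0 (gtn_eqF p0) E numq_int denq_int !absz_nat /=.
by rewrite logn1 lognE p_prime p0 dvdnn divnn p0 logn1.
Qed.

Lemma navQ_p : vQ p%:R = p%:R^-1.
Proof.
by case: Qp_compl => _ _ vi _; rewrite -padic_abs_p -vi rmorph_nat.
Qed.

Lemma padic_residue a : vQ a <= 1 ->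
  exists2 n, (n < p)%N & vQ (a - n%:R) < 1.
Proof.
move=> a1; have p1 := prime_gt1 p_prime; have p0 := prime_gt0 p_prime.
have [_ _ vi dense] := Qp_compl.
have [q aq] := dense a 1 ltr01.
have q1 : vQ (i q) <= 1.
  by rewrite -(subKr a (i q)); apply: (navB_le QA) => //; apply: ltW.
suff [n np qn] : exists2 n, (n < p)%N & vQ (i q - n%:R) < 1.
  by exists n => //; apply: (nav_trans_lt QA aq).
have vp1 : vQ p%:R < 1 by rewrite navQ_p invf_lt1 ?ltr1n ?ltr0n.
(* If p divided the denominator, it would not divide the numerator, and the absolute value of q
   would be a positive power of p. *)
have cop : coprime p `|denq q|.
  rewrite prime_coprime //; apply/negP => pD.
  have D0 : (0 < `|denq q|)%N by rewrite absz_gt0 denq_neq0.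
  have h1 : (0 < logn p `|denq q|)%N by rewrite logn_gt0 mem_primes p_prime D0.
  have : ~~ (p %| `|numq q|)%N.
    apply/negP => pN; have := coprime_num_den q.
    by rewrite /coprime => /eqP g1; have := dvdn_gcd p `|numq q| `|denq q|;
      rewrite pN pD g1 dvdn1; lia.
  move=> pN; have h2 : logn p `|numq q| = 0%N.
    by rewrite lognE (negbTE pN) !andbF.
  have q0 : q != 0 by apply: contraNneq pN => ->; rewrite dvdn0.
  move: q1; rewrite vi /padic_abs (negbTE q0) h2 subr0 -exprnP.
  by rewrite leNgt exprn_egt1 ?ltr1n // -lt0n h1.
have /coprimezP[[u w] /= uw] : coprimez (denq q) p%:Z.
  by rewrite coprimezE coprime_sym absz_nat.
(* By the Bezout relation [u] inverts the denominator modulo [p], so [n] represents the residue of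
   [q]. *)
pose n := ((numq q * u) %% p%:Z)%Z.
have n0 : 0 <= n by rewrite modz_ge0 // lt0r_neq0.
have np : n < p%:Z by rewrite ltz_pmod.
exists `|n|%N; first by lia.
have nR : (`|n|%N)%:R = n%:~R :> Qp by rewrite pmulrn gez0_abs.
have qD : i q * (denq q)%:~R = (numq q)%:~R.
  by rewrite -(rmorph_int i) -rmorphM -numqE rmorph_int.
have [k Dk] : exists k : int, numq q - denq q * n = k * p%:Z.
  exists (numq q * w + denq q * ((numq q * u) %/ p%:Z)%Z).
  set t := ((numq q * u) %/ p%:Z)%Z.
  have nE : n = numq q * u - t * p%:Z.
    by rewrite {1}(divz_eq (numq q * u) p%:Z) addrC addKr.
  rewrite nE; transitivity
    (numq q * (u * denq q + w * p%:Z) - denq q * (numq q * u - t * p%:Z)).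
    by rewrite uw mulr1.
  by ring.
have vD : vQ (denq q)%:~R = 1.
  have : (u%:~R : Qp) * (denq q)%:~R = 1 - w%:~R * p%:R.
    by apply/eqP; rewrite eq_sym subr_eq (pmulrn 1 p) -!intrM -intrD uw.
  move/(congr1 vQ); rewrite [RHS]navDr ?nav1 ?navN ?navM //; last first.
    apply: le_lt_trans vp1; rewrite ler_piMl ?nav_ge0 ?nav_int //.
  move=> E; apply/eqP; rewrite eq_le nav_int // -E ler_piMl ?nav_ge0 ?nav_int //.
rewrite nR -[X in X < _]mulr1 -vD -navM // mulrBl qD mulrC -intrM -intrB.
rewrite mulrC [n * _]mulrC Dk intrM -pmulrn navM //.
by rewrite vD; apply: le_lt_trans vp1; rewrite ler_piMl ?nav_ge0 ?nav_int.
Qed.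

(** Divide an annihilating polynomial by its coefficient of maximal size, taking the last such index
    m: the coefficients beyond m become smaller than 1 and drop out of the relation over the residue
    field, which is then monic of degree m. *)
Lemma algebraic_monic_relation y : algebraicOver j y ->
  exists (m : nat) (b : nat -> Qp), vL y <= 1 ->
    (forall t, vQ (b t) <= 1) /\ vL (y ^+ m - \sum_(t < m) j (b t) * y ^+ t) < 1.
Proof.
case=> P P0 /rootP yP.
have sP : (0 < size P)%N by rewrite size_poly_gt0.
pose t0 := Ordinal sP.
pose tm := [arg max_(t > t0) vQ P`_t]%O.
have tmP (t : nat) : vQ P`_t <= vQ P`_tm.
  have [h|h] := ltnP t (size P); last by rewrite nth_default ?nav0 ?nav_ge0.
  by rewrite /tm; case: Order.TotalTheory.arg_maxP => // s _ /(_ (Ordinal h)); apply.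
have cm : exists n, (n < size P)%N && (vQ P`_n == vQ P`_tm).
  by exists tm; rewrite ltn_ord eqxx.
have cb n : (n < size P)%N && (vQ P`_n == vQ P`_tm) -> (n <= size P)%N.
  by case/andP => /ltnW.
case: (ex_maxnP cm cb) => m /andP[mP /eqP mE] mmax.
have Pm0 : 0 < vQ P`_m.
  rewrite mE; apply: lt_le_trans (tmP (size P).-1).
  by rewrite -lead_coefE nav_gt0 // lead_coef_eq0.
have Pm0' : P`_m != 0 by rewrite -(nav_gt0 QA).
exists m, (fun t => - P`_t / P`_m) => y1; split.
  by move=> t; rewrite navM // navV // navN // ler_pdivrMr // mul1r mE.
have -> : y ^+ m - \sum_(t < m) j (- P`_t / P`_m) * y ^+ t =
    - \sum_(m.+1 <= t < size P) j (P`_t / P`_m) * y ^+ t.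
  have E : \sum_(t < size P) j (P`_t / P`_m) * y ^+ t = 0.
    transitivity ((map_poly j P).[y] / j P`_m); last by rewrite yP mul0r.
    rewrite horner_coef (size_map_poly j) mulr_suml; apply: eq_bigr => t _.
    by rewrite coef_map /= rmorphM /= fmorphV mulrAC.
  have -> : \sum_(t < m) j (- P`_t / P`_m) * y ^+ t =
      - \sum_(t < m) j (P`_t / P`_m) * y ^+ t.
    by rewrite -sumrN; apply: eq_bigr => t _; rewrite mulNr rmorphN mulNr.
  move: E; rewrite -(big_mkord xpredT (fun t => j (P`_t / P`_m) * y ^+ t)).
  rewrite (big_cat_nat (n := m)) ?(ltnW mP) //= (big_ltn mP) mulfV // rmorph1 mul1r.
  rewrite big_mkord addrCA => /eqP; rewrite addrA addr_eq0 opprK => /eqP <-.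
  by rewrite addrC.
rewrite navN // big_seq_cond; apply: (nav_sum_lt LA) => // t.
rewrite andbT mem_index_iota => /andP[mt tP].
rewrite navM // vj.
apply: (@le_lt_trans _ _ (vQ (P`_t / P`_m))).
  by rewrite ler_piMr ?nav_ge0 // navX_le1.
rewrite navM // navV // ltr_pdivrMr // mul1r mE lt_neqAle tmP andbT.
apply/negP => E; have := mmax t; rewrite tP E => /(_ isT).
by rewrite leqNgt mt.
Qed.

Lemma power_reduction (y : L) (m : nat) (b : nat -> Qp) : vL y <= 1 ->
  (forall t, vQ (b t) <= 1) -> vL (y ^+ m - \sum_(t < m) j (b t) * y ^+ t) < 1 ->
  forall n, exists2 a : nat -> Qp, forall t, vQ (a t) <= 1 &
    vL (y ^+ n - \sum_(t < m) j (a t) * y ^+ t) < 1.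
Proof.
move=> y1 b1 hm; elim=> [|n [a a1 ha]].
  case: m hm => [|m] hm.
    exists (fun _ => 0) => [_|]; first by rewrite (nav0 QA).
    by move: hm; rewrite !big_ord0.
  exists (fun t => (t == 0)%:R) => [t|]; first exact: nav_nat.
  rewrite big_ord_recl /= rmorph1 expr0 mul1r big1 ?addr0 ?subrr ?nav0 // => t _.
  by rewrite rmorph0 mul0r.
case: m hm ha => [|m] hm ha.
  exists (fun _ => 0) => [t|]; first by rewrite nav0.
  rewrite big_ord0 subr0 exprS navM // -[_ ^+ n]subr0.
  move: ha; rewrite big_ord0 => ha.
  by apply: le_lt_trans ha; rewrite ler_piMl ?nav_ge0.
(* Multiplication by [y] shifts the coefficients, and the top power that appears is replaced through
   the monic relation. *)
exists (fun t => (if t is t'.+1 then a t' else 0) + a m * b t) => [t|].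
  apply: navD_le => //; last by rewrite navM // mulr_ile1 ?nav_ge0.
  by case: t => [|t] //; rewrite nav0.
apply: (nav_trans_lt LA (y := y * \sum_(t < m.+1) j (a t) * y ^+ t)).
  rewrite exprS -mulrBr navM //; apply: le_lt_trans ha.
  by rewrite ler_piMl ?nav_ge0.
have -> : y * (\sum_(t < m.+1) j (a t) * y ^+ t) -
    \sum_(t < m.+1) j ((if (t : nat) is t'.+1 then a t' else 0) + a m * b t) * y ^+ t
   = j (a m) * (y ^+ m.+1 - \sum_(t < m.+1) j (b t) * y ^+ t).
  rewrite [in RHS]mulrBr [in RHS]mulr_sumr.
  under [X in _ - X = _]eq_bigr do rewrite rmorphD rmorphM mulrDl -mulrA.
  rewrite big_split /= opprD addrA; congr (_ - _).
  rewrite big_ord_recr big_ord_recl /= rmorph0 mul0r add0r mulrDr mulr_sumr.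
  rewrite addrAC (_ : \sum_(t < m) _ = \sum_(t < m) j (a (bump 0 t).-1) * y ^+ bump 0 t).
    by rewrite subrr add0r mulrCA -exprS.
  by apply: eq_bigr => t _; rewrite /bump /= add1n exprS mulrCA.
rewrite navM //; apply: le_lt_trans hm; rewrite ler_piMl ?nav_ge0 // vj.
exact: a1.
Qed.

(* The residue field is algebraic over [F_p]: the powers of an integral
   algebraic element take finitely many residues, so two of its iterated
   Frobenius images have the same one. *)
Lemma algebraic_frobenius_periodic y : algebraicOver j y -> vL y <= 1 ->
  exists2 l, (0 < l)%N & vL (y ^+ (p ^ l) - y) < 1.
Proof.
move=> /algebraic_monic_relation[m [b /[swap] y1 /(_ y1)[b1 hb]]].
have p0 := prime_gt0 p_prime.
have vp1 : vL p%:R < 1.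
  by rewrite -(rmorph_nat j) vj navQ_p invf_lt1 ?ltr1n ?ltr0n ?prime_gt1.
have red n : exists g : {ffun 'I_m -> 'I_p},
    vL (y ^+ n - \sum_(t < m) (g t : nat)%:R * y ^+ t) < 1.
  have [a a1 ha] := power_reduction y1 b1 hb n.
  have /choice[g hg] (t : 'I_m) : exists g : 'I_p, vQ (a t - (g : nat)%:R) < 1.
    by have [k kp hk] := padic_residue (a1 t); exists (Ordinal kp).
  exists [ffun t => g t]; apply: (nav_trans_lt LA ha).
  rewrite -sumrB; apply: (nav_sum_lt LA) => // t _.
  rewrite ffunE -mulrBl navM // -(rmorph_nat j) -rmorphB vj.
  by apply: le_lt_trans (hg t); rewrite ler_piMr ?nav_ge0 // navX_le1.
have /choice[g hg] n : exists g : {ffun 'I_m -> 'I_p},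
    vL (y ^+ (p ^ n) - \sum_(t < m) (g t : nat)%:R * y ^+ t) < 1 by exact: red.
pose T := {ffun 'I_m -> 'I_p}.
have [s [t [st gst]]] : exists s t : nat, (s < t)%N /\ g s = g t.
  apply: contrapT => H.
  have inj : injective (fun s : 'I_(#|T|.+1) => g s : T).
    move=> s t E; apply/val_inj; have [||//] := ltngtP s t => h; case: H.
      by exists s, t.
    by exists t, s.
  by have := leq_card _ inj; rewrite card_ord ltnn.
exists (t - s)%N; first by rewrite subn_gt0.
have h1 n : vL (y ^+ n) <= 1 by apply: navX_le1.
(* Frobenius is injective on the residue field: modulo p, (y^(p^(t-s)) - y)^(p^s) is y^(p^t) -
   y^(p^s), which is small. *)
apply: (@nav_expX_lt1 _ _ _ LA _ (p ^ s)).
rewrite -(subKr ((y ^+ (p ^ (t - s))) ^+ (p ^ s) - y ^+ (p ^ s)) (_ ^+ (p ^ s))).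
apply: (navB_lt LA); last first.
  by apply: le_lt_trans vp1; apply: nav_frobenius_iter.
rewrite -exprM -expnD subnK; last exact: ltnW.
apply: (nav_trans_lt LA (hg t)); rewrite navBC // -gst; exact: hg.
Qed.

End Residue.

(** The interface between the tower of completions and the analysis, which refers to C_p only
    through these properties. *)
Record Cp_like (R : realType) (p : nat) (C : fieldType) (v : C -> R) : Prop := CpLike {
  Cp_abs : nonarch_abs v;
  Cp_complete : vcomplete v;
  Cp_p_gt0 : 0 < v p%:R;
  Cp_p_lt1 : v p%:R < 1;
  Cp_char0 : forall n, n.+1%:R != 0 :> C;
  Cp_roots : forall P : {poly C}, (1 < size P)%N -> exists r, root P r;
  Cp_residue : forall z, v z <= 1 ->
    exists2 l, (0 < l)%N & v (z ^+ (p ^ l) - z) < 1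
}.

Lemma is_Cp_like (R : realType) (p : nat) (C : fieldType) (v : C -> R) :
  prime p -> is_Cp p v -> Cp_like p v.
Proof.
move=> p_prime [Qp [vQ [i [Qb [vb [j [k [hQ [Qb_closed Qb_alg] bA vj hC]]]]]]]].
have [CA Ccomp vk kd] := hC.
have p1 := prime_gt1 p_prime; have p0 := prime_gt0 p_prime.
have vp : v p%:R = p%:R^-1.
  by rewrite -(rmorph_nat k) vk -(rmorph_nat j) vj (navQ_p p_prime hQ).
split=> //.
- by rewrite vp invr_gt0 ltr0n.
- by rewrite vp invf_lt1 ?ltr1n ?ltr0n.
- move=> n; rewrite -(rmorph_nat k) -(rmorph_nat j) -(rmorph_nat i) !fmorph_eq0.
  by rewrite pnatr_eq0.
- exact: (closed_completion_root CA Ccomp Qb_closed kd).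
move=> z z1; have [y zy] := kd z 1 ltr01.
have y1 : v (k y) <= 1.
  by rewrite -(subKr z (k y)); apply: (navB_le CA) => //; apply: ltW.
have [|l l0 hl] := algebraic_frobenius_periodic p_prime hQ bA vj (Qb_alg y).
  by rewrite -vk.
exists l => //; apply: (nav_trans_lt CA (y := k y ^+ (p ^ l))).
  by apply: le_lt_trans zy; apply: nav_subX.
apply: (nav_trans_lt CA (y := k y)); last by rewrite navBC.
by rewrite -rmorphXn -rmorphB vk.
Qed.

(** * Injective power series *)

Section Series.
Context {R : realType} {K : fieldType} {v : K -> R} (vA : nonarch_abs v).
Implicit Types (x y t : K) (e : R) (c : nat -> K).

Definition null_seq c := forall e, 0 < e ->
  exists N : nat, forall n, (N <= n)%N -> v (c n) <= e.

Definition trunc c n : {poly K} := \poly_(i < n) c i.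

(** A Cauchy sequence for the Gauss norm stands for a power series converging on the closed unit
    disc, so that algebra on series can be done on polynomials. *)
Definition gauss_cauchy (W : nat -> {poly K}) := forall e, 0 < e ->
  exists N : nat, forall m n, (N <= m)%N -> (N <= n)%N -> gauss_le v e (W m - W n).

Lemma coef_trunc c n i : (trunc c n)`_i = if (i < n)%N then c i else 0.
Proof. by rewrite coef_poly. Qed.

Lemma horner_trunc c n t : (trunc c n).[t] = \sum_(0 <= i < n) c i * t ^+ i.
Proof. by rewrite horner_poly big_mkord. Qed.

Lemma deriv_trunc c n : (trunc c n.+1)^`() = trunc (fun i => c i.+1 *+ i.+1) n.
Proof.
apply/polyP => i; rewrite coef_deriv !coef_trunc ltnS.
by case: ifP => // _; rewrite mul0rn.
Qed.

Lemma gauss_le_trunc e c n : 0 <= e -> (forall i, v (c i) <= e) ->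
  gauss_le v e (trunc c n).
Proof. by move=> e0 h i; rewrite coef_trunc; case: ifP; rewrite ?nav0. Qed.

Lemma trunc_cauchy c : null_seq c -> gauss_cauchy (trunc c).
Proof.
move=> h e e0; have [N hN] := h e e0; exists N => m n hm hn i.
rewrite coefB !coef_trunc.
by case: ltnP => im; case: ltnP => jn; rewrite ?subrr ?subr0 ?sub0r ?navN ?nav0 ?(ltW e0) //;
  apply: hN; lia.
Qed.

Lemma null_seq_le c (m : nat) : null_seq c -> (forall n, (m < n)%N -> v (c n) < 1) ->
  exists th : R, [/\ 0 <= th, th < 1 & forall n, (m < n)%N -> v (c n) <= th].
Proof.
move=> hc h1; have [|N hN] := hc 2^-1; first by rewrite invr_gt0.
suff [th [t0 t1 ht]] : exists th : R, [/\ 0 <= th, th < 1 &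
    forall n, (m < n < N)%N -> v (c n) <= th].
  exists (Num.max th 2^-1); split.
  - by rewrite le_max t0.
  - by rewrite gt_max t1 invf_lt1 // ltr1n.
  - move=> n mn; rewrite le_max; have [nN|nN] := ltnP n N.
      by rewrite ht ?mn.
    by rewrite hN ?orbT.
elim: N {hN} => [|N [th [t0 t1 ht]]].
  by exists 0; split=> // n; rewrite ltn0 andbF.
have [Nm|mN] := leqP N m.
  by exists 0; split=> // n; lia.
exists (Num.max th (v (c N))); split.
- by rewrite le_max t0.
- by rewrite gt_max t1 h1.
move=> n /andP[mn]; rewrite ltnS leq_eqVlt => /orP[/eqP->|nN].
  by rewrite le_max lexx orbT.
by rewrite le_max ht ?mn.
Qed.

(** The last index of maximal size. Index 0 is left out because the constant term cancels in x(t) -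
    x(tau); [N] counts the zeros of this difference in the closed unit disc. *)
Lemma null_seq_max c n0 : null_seq c -> (0 < n0)%N -> c n0 != 0 ->
  exists N, [/\ (0 < N)%N, c N != 0, forall n, (0 < n)%N -> v (c n) <= v (c N)
    & forall n, (N < n)%N -> v (c n) < v (c N)].
Proof.
move=> hc n00 cn0; have vn0 : 0 < v (c n0) by rewrite nav_gt0.
have [|M hM] := hc (v (c n0) / 2); first by rewrite divr_gt0.
have {}hM n : (M <= n)%N -> v (c n) < v (c n0).
  move=> /hM hn; apply: le_lt_trans hn _.
  by rewrite ltr_pdivrMr // ltr_pMr // ltr1n.
have n0M : (n0 < M)%N.
  by rewrite ltnNge; apply/negP => /hM; rewrite ltxx.
pose tm := [arg max_(t > Ordinal n0M | (0 < t)%N) v (c t)]%O.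
have [tm0 tmP] : (0 < tm)%N /\ forall t : 'I_M, (0 < t)%N -> v (c t) <= v (c tm).
  by rewrite /tm; case: Order.TotalTheory.arg_maxP.
have {}tmP n : (0 < n)%N -> v (c n) <= v (c tm).
  move=> n_gt0; have [nM|/hM nM] := ltnP n M; first exact: (tmP (Ordinal nM)).
  by apply: le_trans (ltW nM) _; apply: (tmP (Ordinal n0M)).
have ex : exists n, (0 < n)%N && (v (c n) == v (c tm)).
  by exists tm; rewrite tm0 eqxx.
have bd n : (0 < n)%N && (v (c n) == v (c tm)) -> (n <= M)%N.
  case/andP => _ /eqP E; rewrite leqNgt; apply/negP => /ltnW/hM.
  by rewrite E ltNge tmP.
case: (ex_maxnP ex bd) => N /andP[N0 /eqP NE] Nmax.
exists N; split=> //.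
- rewrite -(nav_gt0 vA) NE; apply: lt_le_trans vn0 _; exact: tmP.
- by move=> n; rewrite NE; apply: tmP.
move=> n Nn; have n_gt0 : (0 < n)%N by apply: leq_trans Nn.
rewrite NE lt_neqAle tmP // andbT; apply/negP => E.
by have := Nmax n; rewrite n_gt0 E leqNgt Nn => /(_ isT).
Qed.

End Series.

Arguments null_seq {R K} v c.
Arguments gauss_cauchy {R K} v W.

Section Injectivity.
Context {R : realType} {p : nat} {K : fieldType} {v : K -> R} (KC : Cp_like p v).
Implicit Types (x y t : K) (e : R) (c : nat -> K).

Let vA := Cp_abs KC.

Lemma nav_small_exists e : 0 < e -> exists2 t, t != 0 & v t < e.
Proof.
move=> e0; have [N hN] := geometric_small (ltW (Cp_p_gt0 KC)) (Cp_p_lt1 KC) (divr_gt0 e0 (ltr0Sn R 1)).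
exists (p%:R ^+ N); first by rewrite expf_neq0 // -(nav_gt0 vA) (Cp_p_gt0 KC).
rewrite navX //; apply: le_lt_trans (hN N (leqnn _)) _.
by rewrite ltr_pdivrMr // ltr_pMr // ltr1n.
Qed.

Lemma series_identity c : (forall n, v (c n) <= 1) ->
  (forall t, v t <= 1 -> vcvg v (fun n => (trunc c n).[t]) 0) ->
  forall n, c n = 0.
Proof.
move=> c1 h n; apply: contrapT => /eqP cn.
have ex : exists n, c n != 0 by exists n.
case: (ex_minnP ex) => {cn}n cn nmin.
have vn : 0 < v (c n) by rewrite nav_gt0.
(* With |t| < |c_n| and coefficients of size at most 1, the lowest term c_n t^n exceeds all later
   ones. *)
have [t t0 tn] := nav_small_exists vn.
have vt0 : 0 < v t by rewrite nav_gt0.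
have t1 : v t <= 1 by apply: le_trans (ltW tn) (c1 n).
have m0 : 0 < v (c n * t ^+ n) by rewrite nav_gt0 // mulf_neq0 ?expf_neq0.
have [N hN] := (vcvgP vA _ _).1 (h t t1) _ (divr_gt0 m0 (ltr0Sn R 1)).
have := hN (maxn N n.+1) (leq_maxl _ _); set m := maxn _ _.
have nm : (n < m)%N by apply: leq_maxr.
rewrite subr0 horner_trunc (big_cat_nat (n := n)) ?(ltnW nm) //= big_nat big1 ?add0r; last first.
  move=> i /andP[_ ilt]; have [->|ci] := eqVneq (c i) 0; first by rewrite mul0r.
  by have := nmin _ ci; rewrite leqNgt ilt.
rewrite (big_ltn nm) navDr //; first by rewrite leNgt ltr_pdivrMr // ltr_pMr // ltr1n.
rewrite big_seq_cond; apply: (nav_sum_lt vA) => // i.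
rewrite andbT mem_index_iota => /andP[ni _].
rewrite !navM // !(navX vA); apply: (@le_lt_trans _ _ (v t * v t ^+ n)); last first.
  by rewrite ltr_pM2r // exprn_gt0.
rewrite -exprS; apply: (@le_trans _ _ (v t ^+ i)).
  by rewrite ler_piMl ?exprn_ge0 ?nav_ge0.
by apply: ler_wiXn2l; rewrite ?nav_ge0.
Qed.

(* Division of the truncations by [X - tau] realises the difference quotient. *)
Lemma quotient_seq c tau : v tau <= 1 -> null_seq v c ->
  exists U : nat -> {poly K},
  [/\ forall n, trunc c n - ((trunc c n).[tau])%:P = U n * ('X - tau%:P),
      gauss_cauchy v U &
      forall e (m : nat), 0 <= e -> (forall i, (m < i)%N -> v (c i) <= e) ->
        forall n i, (m <= i)%N -> v (U n)`_i <= e].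
Proof.
move=> tau1 hc.
have ex n : exists U, trunc c n - ((trunc c n).[tau])%:P = U * ('X - tau%:P).
  by apply/factor_theorem/rootP; rewrite !hornerE subrr.
have [U UE] := choice ex; exists U; split=> //.
  move=> e e0; have [N hN] := trunc_cauchy vA hc e0; exists N => m n hm hn i.
  apply: (@gauss_le_divX _ _ _ vA e 0 ((trunc c m - trunc c n) -
    ((trunc c m).[tau] - (trunc c n).[tau])%:P) (U m - U n) tau) => //.
  - exact: ltW.
  - by rewrite mulrBl -!UE rmorphB /=; ring.
  move=> {}i i0; rewrite coefB coefC gtn_eqF // subr0.
  exact: hN.
move=> e m e0 hm n i mi.
apply: (@gauss_le_divX _ _ _ vA e m _ (U n) tau _ _ (UE n)) => // {mi}i mi.
rewrite coefB coefC gtn_eqF ?(leq_trans _ mi) // subr0 coef_trunc.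
by case: ifP; rewrite ?nav0 // => _; apply: hm.
Qed.

Lemma injective_series_normalized c (G : K -> K) N : null_seq v c ->
  (forall t, v t <= 1 -> vcvg v (fun n => (trunc c n).[t]) (G t)) ->
  (forall s t, v s <= 1 -> v t <= 1 -> G s = G t -> s = t) ->
  (forall n, (0 < n)%N -> v (c n) <= 1) -> v (c N) = 1 ->
  (forall n, (N < n)%N -> v (c n) < 1) -> (1 < N)%N -> False.
Proof.
move=> hc hG inj c1 cN clt N1.
have [th [th0 th1 hth]] := null_seq_le hc clt.
pose d := N.-1; have NE : N = d.+1 by rewrite prednK // ltnW.
have d0 : (0 < d)%N by rewrite -ltnS -NE.
pose c' i := c i.+1 *+ i.+1.
have dG tau : v tau <= 1 -> vcvg v (fun n => (trunc c' n).[tau]) 0.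
  move=> tau1; have [U [UE Ucau Ucoef]] := quotient_seq tau1 hc.
  have U1 n : gauss_le v 1 (U n) by move=> i; apply: (Ucoef 1 0%N).
  have Ulow n i : (d < i)%N -> v (U n)`_i <= th.
    by move=> di; apply: (Ucoef th N) => //; rewrite NE.
  have Ud n : (N < n)%N -> v (U n)`_d = 1.
    move=> Nn; have : (U n)`_d = c N + (U n)`_N * tau.
      have := congr1 (fun P : {poly K} => P`_N) (UE n).
      rewrite coefB coefC (gtn_eqF (ltnW N1)) subr0 coef_trunc Nn => ->.
      by rewrite mulrBr coefB coefMX coefMC NE /= subrK.
    move=> ->; rewrite navDr // cN navM //; apply: le_lt_trans th1.
    apply: le_trans (Ulow n N _); last by rewrite NE.
    by rewrite ler_piMr ?nav_ge0.
  have half0 n : 0 < (2^-1 ^+ n) ^+ d :> R by rewrite !exprn_gt0 // invr_gt0.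
  have [M hM] := choice (fun n => Ucau _ (half0 n)).
  (* A subsequence fast enough for the geometric rate required by [limit_root], and beyond [N],
     where the coefficient [d] of [U] is a unit. *)
  pose S n := (\sum_(i < n.+1) M i + (N + n).+1)%N.
  have SM n : (M n <= S n)%N by rewrite /S big_ord_recr /= -addnA addnCA leq_addr.
  have SS n : (M n <= S n.+1)%N.
    apply: leq_trans (SM n) _; rewrite /S [in leqRHS]big_ord_recr /=; lia.
  have SN n : (N < S n)%N by rewrite /S; lia.
  have big n : (n <= S n)%N by rewrite /S; lia.
  have sp := splits_of_roots (Cp_roots KC).
  have [|||||r r1 hr] := @limit_root _ _ _ vA (Cp_complete KC) (U \o S) d d0.
  - by move=> n; apply: sp.
  - by move=> n; apply: U1.
  - by move=> n; apply: Ud.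
  - by move=> n i di; apply: le_lt_trans (Ulow _ _ di) th1.
  - by move=> n; apply: hM.
  have hU e : 0 < e -> exists n0, forall n, (n0 <= n)%N -> v (U n).[r] <= e.
    move=> e0; have [n0 hn0] := hr e e0; have [n1 hn1] := Ucau e e0.
    exists n1 => n n1n; pose q := maxn n0 n1.
    rewrite -[_.[r]](subrK (U (S q)).[r]); apply: navD_le => //; last first.
      by apply: hn0; apply: leq_maxl.
    rewrite -hornerN -hornerD; apply: (gauss_le_horner vA) => //; apply: hn1 => //.
    by apply: leq_trans (big q); apply: leq_maxr.
  (* In the limit G(r) - G(tau) = U(r)(r - tau) = 0, so injectivity applies. *)
  have rtau : r = tau.
    apply: inj => //; apply/eqP; rewrite -subr_eq0; apply/eqP.
    apply: (nav_small_eq0 vA) => e e0.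
    have [n0 hn0] := hU e e0.
    have [n1 hn1] := (vcvgP vA _ _).1 (hG r r1) e e0.
    have [n2 hn2] := (vcvgP vA _ _).1 (hG tau tau1) e e0.
    pose n := maxn n0 (maxn n1 n2).
    have := hn1 n; rewrite !leq_max leqnn orbT => /(_ isT) h1.
    have := hn2 n; rewrite !leq_max leqnn !orbT => /(_ isT) h2.
    apply: (nav_trans_le vA (y := (trunc c n).[r])); first by rewrite navBC.
    apply: (nav_trans_le vA _ h2).
    have -> : (trunc c n).[r] - (trunc c n).[tau] = (U n).[r] * (r - tau).
      have := congr1 (fun P : {poly K} => P.[r]) (UE n).
      by rewrite !hornerE.
    rewrite navM //; apply: (@le_trans _ _ (v (U n).[r])).
      by rewrite ler_piMr ?nav_ge0 // navB_le.
    by apply: hn0; rewrite leq_maxl.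
  rewrite rtau in hU; apply/(vcvgP vA) => e e0; have [n0 hn0] := hU e e0.
  exists n0 => n n0n; rewrite subr0 -deriv_trunc.
  (* At tau the derivative equals the quotient itself, which tends to 0 there. *)
  have -> : (trunc c n.+1)^`() = (U n.+1)^`() * ('X - tau%:P) + U n.+1.
    have := congr1 (fun P : {poly K} => P^`()) (UE n.+1).
    by rewrite derivB derivC subr0 derivM derivXsubC mulr1.
  rewrite !hornerE subrr mulr0 add0r; apply: hn0.
  exact: leqW.
have c'0 n : c' n = 0.
  apply: series_identity => // {}n; rewrite /c' -mulr_natl navM //.
  by rewrite mulr_ile1 ?nav_ge0 ?nav_nat ?c1.
(* This coefficient of the derivative is N c_N, nonzero in characteristic 0. *)
have := c'0 d; rewrite /c' -NE => /eqP; rewrite NE -mulr_natl mulf_eq0.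
rewrite (negbTE (Cp_char0 KC d)) /= -NE => /eqP cN0.
by move: cN; rewrite cN0 nav0 // => /eqP; rewrite eq_sym oner_eq0.
Qed.

Lemma injective_series_dominant c (G : K -> K) : null_seq v c ->
  (forall t, v t <= 1 -> vcvg v (fun n => (trunc c n).[t]) (G t)) ->
  (forall s t, v s <= 1 -> v t <= 1 -> G s = G t -> s = t) ->
  c 1%N != 0 /\ forall n, (1 < n)%N -> v (c n) < v (c 1%N).
Proof.
move=> hc hG inj.
have [n0 n00 cn0] : exists2 n0, (0 < n0)%N & c n0 != 0.
  apply: contrapT => H.
  have c0 n : (0 < n)%N -> c n = 0.
    by move=> n0; apply: contrapT => /eqP cn; apply: H; exists n.
  have E t n : (trunc c n.+1).[t] = c 0%N.
    rewrite horner_trunc big_nat_recl // expr0 mulr1 big1 ?addr0 // => i _.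
    by rewrite c0 // mul0r.
  have GE t : v t <= 1 -> G t = c 0%N.
    move=> /hG h; apply: (vcvg_unique vA h); apply/(vcvgP vA) => e e0.
    by exists 1%N => -[//|n] _; rewrite E subrr nav0 // ltW.
  have := inj 0 1; rewrite nav0 // nav1 // ler01 lexx !GE ?nav0 ?nav1 //.
  by move=> /(_ isT isT erefl)/eqP; rewrite eq_sym oner_eq0.
have [N [N0 cN hle hlt]] := null_seq_max vA hc n00 cn0.
have vN : 0 < v (c N) by rewrite nav_gt0.
have [N1|N1] := leqP N 1.
  by have EN : N = 1%N by [lia]; subst N.
exfalso; apply: (@injective_series_normalized (fun n => c n / c N) (fun t => G t / c N) N) => //.
- move=> e e0; have [M hM] := hc _ (mulr_gt0 e0 vN); exists M => n /hM.
  by rewrite navM // navV // ler_pdivrMr.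
- move=> t /hG /(vcvgP vA) h; apply/(vcvgP vA) => e e0.
  have [M hM] := h _ (mulr_gt0 e0 vN); exists M => n /hM.
  rewrite -ler_pdivrMr // -navV // -navM // mulrBl !horner_trunc mulr_suml.
  by under eq_bigr do rewrite mulrAC.
- move=> s t s1 t1 /(mulIf (invr_neq0 cN)); exact: inj.
- by move=> n n0'; rewrite navM // navV // ler_pdivrMr // mul1r hle.
- by rewrite mulfV // nav1.
- by move=> n Nn; rewrite navM // navV // ltr_pdivrMr // mul1r hlt.
Qed.

End Injectivity.

(** * Means over roots of unity *)

Section Means.
Context {R : realType} {p : nat} {K : fieldType} {v : K -> R}.
Context (p_prime : prime p) (KC : Cp_like p v).
Implicit Types (x y z t c : K) (e h : R) (n : nat) (f g : K -> K) (P W : {poly K}).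

Let vA := Cp_abs KC.
Let p_gt0 : (0 < p)%N := prime_gt0 p_prime.

Let natK_neq0 n : (0 < n)%N -> n%:R != 0 :> K.
Proof. by case: n => // n _; apply: (Cp_char0 KC). Qed.

Lemma unity_roots_enum q : (0 < q)%N -> exists s : seq K,
  [/\ forall F : K -> K, \sum_(z \in @unity_roots K q) F z = \sum_(z <- s) F z,
      forall z, (z \in s) = (z ^+ q == 1) &
      forall j, \sum_(z <- s) z ^+ j = if (q %| j)%N then q%:R else 0].
Proof.
move=> q0; have [s sE] := splits_of_roots (Cp_roots KC) ('X^q - 1).
have mon : ('X^q - 1 : {poly K}) \is monic by apply: monicXnsubC.
rewrite (monicP mon) scale1r in sE.
have us : uniq s.
  by rewrite -separable_prod_XsubC -sE separable_Xn_sub_1 // natK_neq0.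
have ss : size s = q.
  by have := size_prod_XsubC s id; rewrite -sE size_XnsubC // => -[].
have ms z : (z \in s) = (z ^+ q == 1).
  by rewrite -root_prod_XsubC -sE rootE !hornerE subr_eq0.
have all1 : all q.-unity_root s.
  by apply/allP => z; rewrite -root_prod_XsubC -sE.
have /hasP[w ws wq] := has_prim_root q0 all1 us (eq_leq (esym ss)).
exists s; split=> //.
  move=> F; have -> : @unity_roots K q = [set` s].
    by apply/seteqP; split=> z /=; rewrite ms => /eqP.
  by rewrite -fsbig_seq.
have ps : perm_eq [seq w ^+ i | i <- iota 0 q] s.
  apply: uniq_perm => //.
    rewrite map_inj_in_uniq ?iota_uniq // => i j.
    rewrite !mem_iota !add0n => /= iq jq /eqP.
    by rewrite (eq_prim_root_expr wq) !modn_small // => /eqP.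
  have sub z : z \in [seq w ^+ i | i <- iota 0 q] -> z \in s.
    by case/mapP => i _ ->; rewrite ms exprAC (prim_expr_order wq) expr1n.
  have [||//] := uniq_min_size _ sub.
    rewrite map_inj_in_uniq ?iota_uniq // => i j.
    rewrite !mem_iota !add0n => /= iq jq /eqP.
    by rewrite (eq_prim_root_expr wq) !modn_small // => /eqP.
  by rewrite size_map size_iota ss.
move=> j; rewrite -(perm_big _ ps) big_map -[q in iota 0 q]subn0 -/(index_iota 0 q).
rewrite big_mkord; case: ifP => qj.
  rewrite -[RHS]mulr1 mulr_natl -[q in _ *+ q]card_ord -sumr_const.
  apply: eq_bigr => i _; rewrite exprAC.
  by rewrite -(prim_expr_mod wq j) (eqP qj) expr0 expr1n.
have wj : w ^+ j != 1.
  by rewrite -(expr0 w) (eq_prim_root_expr wq) mod0n; apply/negbT.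
have : (w ^+ j - 1) * \sum_(i < q) (w ^+ i) ^+ j = 0.
  transitivity ((w ^+ j) ^+ q - 1).
    by rewrite [RHS]subrX1; congr (_ * _); apply: eq_bigr => i _; rewrite exprAC.
  by rewrite exprAC (prim_expr_order wq) expr1n subrr.
by move/eqP; rewrite mulf_eq0 subr_eq0 (negbTE wj) => /eqP.
Qed.

(** The arc mean for a = 0 and b = 1. The factor [z] stands for x - a; it is why z^i has mean 1
    exactly when p^n divides i + 1. *)
Definition unity_mean n g : K :=
  p%:R ^- n * \sum_(z \in @unity_roots K (p ^ n)) (z * g z).

Let pn_gt0 n : (0 < p ^ n)%N. Proof. by rewrite expn_gt0 p_gt0. Qed.

Lemma unity_mean_ext n f g : (forall z, z ^+ (p ^ n) = 1 -> f z = g z) ->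
  unity_mean n f = unity_mean n g.
Proof.
move=> fg; have [s [sE ms _]] := unity_roots_enum (pn_gt0 n).
rewrite /unity_mean !sE; congr (_ * _); apply: eq_big_seq => z.
by rewrite ms => /eqP /fg ->.
Qed.

Lemma unity_meanD n f g :
  unity_mean n (fun z => f z + g z) = unity_mean n f + unity_mean n g.
Proof.
have [s [sE _ _]] := unity_roots_enum (pn_gt0 n).
rewrite /unity_mean !sE -mulrDr -big_split /=; congr (_ * _).
by apply: eq_bigr => z _; rewrite mulrDr.
Qed.

Lemma unity_meanZ n c f : unity_mean n (fun z => c * f z) = c * unity_mean n f.
Proof.
have [s [sE _ _]] := unity_roots_enum (pn_gt0 n).
rewrite /unity_mean !sE [RHS]mulrCA [in RHS]mulr_sumr; congr (_ * _).
by apply: eq_bigr => z _; rewrite mulrCA.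
Qed.

Lemma unity_meanB n f g :
  unity_mean n (fun z => f z - g z) = unity_mean n f - unity_mean n g.
Proof.
rewrite -[- unity_mean n g]mulN1r -unity_meanZ -unity_meanD.
by apply: unity_mean_ext => z _; rewrite mulN1r.
Qed.

Lemma nav_unity n z : z ^+ (p ^ n) = 1 -> v z = 1.
Proof.
move=> /(congr1 v); rewrite navX // nav1 // => /eqP.
by rewrite pexpr_eq1 ?nav_ge0 ?pn_gt0 // => /eqP.
Qed.

Lemma unity_near1 n z : z ^+ (p ^ n) = 1 -> v (z - 1) ^+ (p ^ n) <= v p%:R.
Proof.
move=> zn; have z1 := nav_unity zn.
have := @nav_frobenius_iter _ _ _ vA _ p_prime z 1 n.
by rewrite z1 nav1 // zn expr1n subrr sub0r navN // navX // => /(_ (lexx _) (lexx _)).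
Qed.

Lemma unity_mean_crude n f h : (forall z, z ^+ (p ^ n) = 1 -> v (f z) <= h) ->
  0 <= h -> v (unity_mean n f) <= h / v p%:R ^+ n.
Proof.
move=> fh h0; have [s [sE ms _]] := unity_roots_enum (pn_gt0 n).
rewrite /unity_mean sE navM // navV // navX // mulrC.
rewrite ler_wpM2r ?invr_ge0 ?exprn_ge0 ?nav_ge0 // big_seq_cond.
apply: (nav_sum vA) => // z; rewrite andbT ms => /eqP zn.
by rewrite navM // (nav_unity zn) mul1r fh.
Qed.

Lemma unity_mean_poly n P : unity_mean n (fun z => P.[z]) =
  \sum_(i < size P) P`_i * (p ^ n %| i.+1)%:R.
Proof.
have [s [sE _ sX]] := unity_roots_enum (pn_gt0 n).
rewrite /unity_mean sE; under eq_bigr do rewrite horner_coef mulr_sumr.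
rewrite exchange_big /= mulr_sumr; apply: eq_bigr => i _.
under eq_bigr do rewrite mulrCA -exprS.
rewrite -mulr_sumr sX mulrCA; congr (_ * _).
case: ifP => _; last by rewrite mulr0.
by rewrite natrX mulVf // expf_neq0 // natK_neq0.
Qed.

Lemma unity_mean_gauss n P h : gauss_le v h P ->
  v (unity_mean n (fun z => P.[z])) <= h.
Proof.
move=> hP; rewrite unity_mean_poly; apply: (nav_sum vA) => [|i _].
  exact: (gauss_le_ge0 vA hP).
by rewrite navM //; apply: (le_trans _ (hP i)); rewrite ler_piMr ?nav_ge0 ?nav_nat.
Qed.

Lemma unity_mean_poly0 n P : (size P < p ^ n)%N -> unity_mean n (fun z => P.[z]) = 0.
Proof.
move=> sP; rewrite unity_mean_poly big1 // => i _.
rewrite gtnNdvd ?mulr0 //; exact: leq_ltn_trans (ltn_ord i) sP.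
Qed.

(** Since [n] is fixed before the error [d], the crude bound can be applied with an error below
    |p|^n times the target; what remains is the Gauss norm of [W]. *)
Lemma unity_mean_approx n g h :
  (forall d, 0 < d -> exists2 W, gauss_le v h W &
     forall z, z ^+ (p ^ n) = 1 -> v (g z - W.[z]) <= d) ->
  v (unity_mean n g) <= h.
Proof.
move=> H; apply/ler_addgt0Pl => d d0.
have pn0 : 0 < v p%:R ^+ n by rewrite exprn_gt0 ?(Cp_p_gt0 KC).
have [W hW gW] := H _ (mulr_gt0 d0 pn0).
have -> : unity_mean n g = unity_mean n (fun z => g z - W.[z]) + unity_mean n (fun z => W.[z]).
  by rewrite unity_meanB subrK.
have h0 : 0 <= h := gauss_le_ge0 vA hW.
apply: navD_le => //.
  apply: le_trans (unity_mean_crude gW _) _; first by rewrite mulr_ge0 ?ltW.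
  by rewrite mulfK ?gt_eqF // lerDl.
by apply: (le_trans (unity_mean_gauss n hW)); rewrite lerDr ltW.
Qed.

(* An analytic function on the closed unit disc, as far as the means see it. *)
Definition disc_analytic g := forall e, 0 < e -> exists W0, forall n d, 0 < d ->
  exists2 W, gauss_le v e (W - W0) &
    forall z, z ^+ (p ^ n) = 1 -> v (g z - W.[z]) <= d.

(** The polynomial [W0] does not depend on [n], so its mean vanishes once p^n exceeds its degree,
    and the remainder has Gauss norm at most [e]. *)
Lemma unity_mean_analytic g : disc_analytic g ->
  forall e, 0 < e -> exists N, forall n, (N <= n)%N -> v (unity_mean n g) <= e.
Proof.
move=> H e e0; have [W0 hW] := H e e0; exists (size W0).+1 => n hn.
have sW : (size W0 < p ^ n)%N.
  by apply: leq_trans hn _; apply/ltnW/ltn_expl/prime_gt1.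
rewrite -[unity_mean n g]subr0 -(unity_mean_poly0 sW) -unity_meanB.
apply: unity_mean_approx => d d0; have [W WW0 gW] := hW n d d0.
exists (W - W0) => // z zn; rewrite hornerD hornerN.
by rewrite opprB addrA subrK gW.
Qed.

(** With q = p^n and z^q = 1, (1 - c^q)/(z - c) is the sum of the c^(q-1-i) z^i for i < q, of which
    only i = q - 1 has a nonzero mean. *)
Lemma unity_mean_pole n c : c ^+ (p ^ n) != 1 ->
  unity_mean n (fun z => (z - c)^-1) = (1 - c ^+ (p ^ n))^-1.
Proof.
move=> cn; have c0 : 1 - c ^+ (p ^ n) != 0 by rewrite subr_eq0 eq_sym.
apply: (mulfI c0); rewrite mulfV // -unity_meanZ.
have [s [sE ms sX]] := unity_roots_enum (pn_gt0 n).
have -> : unity_mean n (fun z => (1 - c ^+ (p ^ n)) * (z - c)^-1) =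
    unity_mean n (fun z => (\poly_(i < p ^ n) c ^+ ((p ^ n).-1 - i)).[z]).
  apply: unity_mean_ext => z zn; have zc : z - c != 0.
    by rewrite subr_eq0; apply: contra cn => /eqP <-; rewrite zn.
  rewrite -zn subrXX mulrAC mulfV // mul1r horner_poly.
  rewrite [RHS](reindex_inj rev_ord_inj) /=; apply: eq_bigr => i _.
  have -> : ((p ^ n).-1 - (p ^ n - i.+1) = i)%N by have := ltn_ord i; lia.
  by rewrite mulrC subnS; congr (_ * _ ^+ _); lia.
rewrite unity_mean_poly size_poly_eq; last by rewrite subnn expr0 oner_eq0.
have lt : ((p ^ n).-1 < p ^ n)%N by rewrite prednK.
rewrite (bigD1 (Ordinal lt)) //= prednK // dvdnn coef_poly lt subnn expr0 mulr1.
rewrite big1 ?addr0 // => i; rewrite -val_eqE /= => ilt.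
by rewrite gtnNdvd ?mulr0 //; have := ltn_ord i; lia.
Qed.

End Means.

Arguments unity_mean p {K} n g.

Arguments disc_analytic {R} p {K} v g.

(** * Rational functions on an open disc *)

Section Rational.
Context {R : realType} {p : nat} {K : fieldType} {v : K -> R}.
Context (p_prime : prime p) (KC : Cp_like p v).
Implicit Types (x y z t : K) (e d h : R) (f g : K -> K) (P Q H : {poly K}).

Let vA := Cp_abs KC.
Let vp0 : 0 < v p%:R := Cp_p_gt0 KC.
Let vp1 : v p%:R < 1 := Cp_p_lt1 KC.

Lemma finite_sup_lt (u : nat -> R) h mu n : h < mu ->
  (forall j, (j < n)%N -> u j < mu) ->
  exists h', [/\ h <= h', h' < mu & forall j, (j < n)%N -> u j <= h'].
Proof.
move=> hmu; elim: n => [|n IH] hu; first by exists h.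
have [|h' [hh' h'mu uh']] := IH; first by move=> j jn; apply/hu/ltnW.
exists (Num.max h' (u n)); split.
- by rewrite le_max hh'.
- by rewrite gt_max h'mu hu.
move=> j; rewrite ltnS leq_eqVlt => /orP[/eqP->|jn].
  by rewrite le_max lexx orbT.
by rewrite le_max uh'.
Qed.

(* Maximum principle: the value group is dense, so [v y] can be taken close
   enough to 1 for the first coefficient of maximal size to dominate. *)
Lemma gauss_le_of_bounded P h : (forall y, v y < 1 -> v P.[y] <= h) ->
  gauss_le v h P.
Proof.
move=> hP; have h0 : 0 <= h by apply: le_trans (hP 0 _); rewrite ?nav_ge0 ?nav0 ?ltr01.
move=> i; rewrite leNgt; apply/negP => hi.
have sP : (0 < size P)%N.
  rewrite size_poly_gt0; apply/eqP => E; move: hi; rewrite E coef0 nav0 //.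
  by rewrite ltNge h0.
pose tm := [arg max_(t > Ordinal sP) v P`_t]%O.
have tmP (t : nat) : v P`_t <= v P`_tm.
  have [ht|ht] := ltnP t (size P); last by rewrite nth_default ?nav0 ?nav_ge0.
  by rewrite /tm; case: Order.TotalTheory.arg_maxP => // s _ /(_ (Ordinal ht)); apply.
have ex : exists t : nat, v P`_t == v P`_tm by exists tm.
case: (ex_minnP ex) => m /eqP mE mmin; set mu := v P`_tm in tmP mE mmin.
have hmu : h < mu := lt_le_trans hi (tmP i).
have mu0 : 0 < mu := le_lt_trans h0 hmu.
have [|h' [hh' h'mu uh']] := @finite_sup_lt (fun j => v P`_j) h mu m hmu.
  move=> j jm; rewrite lt_neqAle tmP andbT; apply/negP => E.
  by have := mmin _ E; rewrite leqNgt jm.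
pose q := h' / mu; have q0 : 0 <= q by rewrite divr_ge0 ?(le_trans h0) // ltW.
have q1 : q < 1 by rewrite ltr_pdivrMr // mul1r.
have [|N hN] := geometric_small q0 q1 (e := v p%:R ^+ m / 2).
  by rewrite divr_gt0 // exprn_gt0.
(* A root of p of high order has absolute value close to 1; [N] is such that |y|^m > q, so that the
   term of degree m exceeds all lower ones. *)
have [|y /rootP yE] := Cp_roots KC (P := 'X^(N.+1) - (p%:R)%:P).
  by rewrite size_XnsubC.
have {}yE : y ^+ N.+1 = p%:R by apply/eqP; rewrite -subr_eq0 -yE !hornerE.
have vyE : v y ^+ N.+1 = v p%:R by rewrite -navX // yE.
have vy1 : v y < 1.
  by rewrite ltNge; apply/negP => h1; have := exprn_ege1 N.+1 h1; rewrite vyE leNgt vp1.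
have vy0 : 0 < v y.
  rewrite lt0r nav_ge0 // andbT; apply/eqP => E; move: vp0.
  by rewrite -vyE E expr0n ltxx.
have qy : q < v y ^+ m.
  have : q ^+ N.+1 < (v y ^+ m) ^+ N.+1.
    rewrite exprAC vyE; apply: le_lt_trans (hN _ (leqnSn _)) _.
    by rewrite ltr_pdivrMr // ltr_pMr ?ltr1n // exprn_gt0.
  by rewrite ltr_pXn2r // nnegrE ?exprn_ge0 ?nav_ge0.
have h'y : h' < mu * v y ^+ m by rewrite mulrC -ltr_pdivrMr.
have mP : (m < size P)%N.
  rewrite ltnNge; apply/negP => /(nth_default 0) E; move: mu0.
  by rewrite -mE E nav0 // ltxx.
have : v P.[y] = mu * v y ^+ m.
  rewrite horner_coef (bigD1 (Ordinal mP)) //= navDr //; first by rewrite navM // navX // mE.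
  rewrite [ltRHS]navM // navX // mE; apply: (nav_sum_lt vA).
    by rewrite mulr_gt0 ?exprn_gt0.
  move=> j; rewrite -val_eqE /= neq_ltn => /orP[jm|mj]; rewrite navM // navX //.
    apply: le_lt_trans h'y; apply: (@le_trans _ _ (v P`_j)); last exact: uh'.
    by rewrite ler_piMr ?nav_ge0 // exprn_ile1 ?nav_ge0 ?ltW.
  apply: (@le_lt_trans _ _ (mu * v y ^+ j)); first by rewrite ler_wpM2r ?exprn_ge0 ?nav_ge0.
  by rewrite ltr_pM2l // ltr_iXn2l.
by move=> E; have := hP y vy1; rewrite E leNgt (le_lt_trans hh' h'y).
Qed.

(** The second hypothesis is the one met by y = z - 1 for a p^n-th root of unity z. It gives powers
    of y a uniform rate of decay for fixed n. *)
Lemma near_small n N d y : v p%:R ^+ N <= d -> v y ^+ (p ^ n) <= v p%:R ->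
  v y ^+ (p ^ n * N) <= d.
Proof.
move=> hN hy; apply: (le_trans _ hN); rewrite exprM.
by rewrite lerXn2r // nnegrE ?exprn_ge0 ?nav_ge0.
Qed.

Lemma near_lt1 n y : v y ^+ (p ^ n) <= v p%:R -> v y < 1.
Proof.
move=> hy; apply: (nav_expX_lt1 vA (n := p ^ n)); rewrite navX //.
exact: le_lt_trans hy vp1.
Qed.

Lemma prod_1subr_eq1 (s : seq K) y : (forall c, c \in s -> 1 <= v c) -> v y < 1 ->
  v (\prod_(c <- s) (1 - y / c)) = 1.
Proof.
move=> hs hy; elim: s hs => [|c s IH] hs; first by rewrite big_nil nav1.
rewrite big_cons navM // IH ?mulr1; last by move=> b bs; apply: hs; rewrite inE bs orbT.
have c1 : 1 <= v c by apply: hs; rewrite inE eqxx.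
have h : v (y / c) < v 1.
  rewrite (nav1 vA) navM // navV // ltr_pdivrMr ?(lt_le_trans ltr01) // mul1r.
  exact: lt_le_trans c1.
by rewrite (navDr vA) ?navN // nav1.
Qed.

Lemma inv_prod_approx (s : seq K) n d : (forall c, c \in s -> 1 <= v c) -> 0 < d ->
  exists2 H, gauss_le v 1 H & forall y, v y ^+ (p ^ n) <= v p%:R ->
    v ((\prod_(c <- s) (1 - y / c))^-1 - H.[y]) <= d.
Proof.
move=> hs d0; elim: s hs => [|c s IH] hs.
  exists 1 => [|y _]; first by apply: (gauss_leC vA (x := 1)); rewrite nav1.
  by rewrite big_nil invr1 hornerC subrr nav0 // ltW.
have hs' b : b \in s -> 1 <= v b by move=> bs; apply: hs; rewrite inE bs orbT.
have [H H1 hH] := IH hs'.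
have c1 : 1 <= v c by apply: hs; rewrite inE eqxx.
have ci1 : v c^-1 <= 1 by rewrite navV // invf_le1 // (lt_le_trans ltr01).
have [N hN] := geometric_small (ltW vp0) vp1 d0.
pose m := (p ^ n * N)%N.
pose T : {poly K} := \sum_(i < m) (c^-1 *: 'X) ^+ i.
have T1 : gauss_le v 1 T.
  apply: (gauss_le_sum vA) => // i _; apply: gauss_leX_exp => //.
  by apply: gauss_leZ => //; apply: gauss_leX.
exists (T * H); first by rewrite -[1]mulr1; apply: gauss_leM.
move=> y hy; have y1 := near_lt1 hy.
set u := y / c; have u1 : v u <= v y by rewrite navM // ler_piMr ?nav_ge0.
have ult1 : v u < 1 := le_lt_trans u1 y1.
have w1 : v (1 - u) = 1 by rewrite (navDr vA) ?navN // nav1.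
have w0 : 1 - u != 0 by rewrite -(nav_gt0 vA) w1.
rewrite big_cons invfM hornerM; apply: nav_mulBB_le => //.
- by rewrite navV // w1 invr1.
- exact: (gauss_le_horner vA H1 (ltW y1)).
- have -> : T.[y] = \sum_(i < m) u ^+ i.
    rewrite horner_sum; apply: eq_bigr => i _.
    by rewrite horner_exp hornerZ hornerX mulrC.
  have -> : (1 - u)^-1 - \sum_(i < m) u ^+ i = u ^+ m / (1 - u).
    apply: (mulfI w0); rewrite mulrBr mulfV // mulrCA mulfV // mulr1.
    have -> : (1 - u) * \sum_(i < m) u ^+ i = 1 - u ^+ m.
      by rewrite -[1 - u]opprB mulNr -subrX1 opprB.
    by rewrite opprB addrC subrK.
  rewrite navM // navV // w1 invr1 mulr1 navX //.
  apply: (@le_trans _ _ (v y ^+ m)); first by rewrite lerXn2r // nnegrE nav_ge0.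
  by apply: near_small hy; apply: hN.
- exact: hH.
Qed.

(** Scaled suitably, the denominator is a product of factors 1 - y/c with |c| >= 1, of absolute
    value exactly 1 on the disc. The scaled numerator is therefore bounded by [h], and by the
    maximum principle so is its Gauss norm. *)
Lemma rational_approx P Q h n d : (forall x, v (x - 1) < 1 -> Q.[x] != 0) ->
  0 <= h -> (forall x, v (x - 1) < 1 -> v (P.[x] / Q.[x]) <= h) -> 0 < d ->
  exists2 H, gauss_le v h H & forall x, v (x - 1) ^+ (p ^ n) <= v p%:R ->
    v (P.[x] / Q.[x] - H.[x - 1]) <= d.
Proof.
move=> Q0 h0 hPQ d0; pose S : {poly K} := 'X + 1%:P.
have ev T y : (T \Po S).[y] = T.[y + 1] by rewrite horner_comp !hornerE.
have [s sE] := splits_of_roots (Cp_roots KC) (Q \Po S).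
set l := lead_coef _ in sE.
have l0 : l != 0.
  rewrite /l lead_coef_eq0; apply/eqP => E; have := Q0 1.
  by rewrite subrr nav0 // ltr01 -[X in Q.[X]]add0r -ev E horner0 eqxx => /(_ isT).
have hs c : c \in s -> 1 <= v c.
  move=> cs; rewrite leNgt; apply/negP => c1; have := Q0 (c + 1).
  rewrite addrK c1 -ev sE hornerZ => /(_ isT).
  by rewrite mulf_eq0 negb_or -[_.[c] == 0]/(root _ c) root_prod_XsubC cs andbF.
have c0 c : c \in s -> c != 0.
  by move=> /hs c1; rewrite -(nav_gt0 vA) (lt_le_trans ltr01).
pose q := l * \prod_(c <- s) (- c).
have q0 : q != 0.
  rewrite mulf_neq0 // prodf_seq_neq0; apply/allP => c cs /=.
  by rewrite oppr_eq0 c0.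
have QE y : Q.[y + 1] = q * \prod_(c <- s) (1 - y / c).
  rewrite -ev sE hornerZ horner_prod -mulrA -big_split /=; congr (_ * _).
  apply: eq_big_seq => c cs; rewrite !hornerE mulrBr mulr1 mulNr opprK.
  by rewrite mulrCA mulfV ?c0 // mulr1 addrC.
pose T := q^-1 *: (P \Po S).
have hT : gauss_le v h T.
  apply: gauss_le_of_bounded => y y1; rewrite hornerZ ev.
  have := hPQ (y + 1); rewrite addrK y1 QE => /(_ isT).
  by rewrite invfM mulrA navM // [v _^-1]navV // prod_1subr_eq1 // invr1 mulr1 mulrC.
(* The added 1 covers the case h = 0. *)
have [|E E1 hE] := @inv_prod_approx s n (d / (h + 1)) hs.
  by rewrite divr_gt0 // ltr_wpDl.
exists (T * E); first by rewrite -[h]mulr1; apply: gauss_leM.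
move=> x hx; have y1 := near_lt1 hx; set y := x - 1 in hx y1 *.
have -> : x = y + 1 by rewrite subrK.
have -> : P.[y + 1] / Q.[y + 1] = T.[y] * (\prod_(c <- s) (1 - y / c))^-1.
  by rewrite QE invfM hornerZ ev mulrA [P.[_] * _]mulrC.
rewrite hornerM -mulrBr navM //.
apply: (@le_trans _ _ (h * (d / (h + 1)))).
  by rewrite ler_pM ?nav_ge0 ?hE //; apply: (gauss_le_horner vA hT (ltW y1)).
rewrite mulrCA ler_piMr ?(ltW d0) // ler_pdivrMr ?mul1r ?ltr_wpDl //.
by rewrite lerDl.
Qed.

End Rational.

(** * Analytic pullbacks *)

Section GaussLimits.
Context {R : realType} {p : nat} {K : fieldType} {v : K -> R}.
Context (vA : nonarch_abs v).
Implicit Types (x y z t : K) (e d h : R) (f g : K -> K) (P Q H : {poly K}).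

Lemma gauss_cauchy_deriv (W : nat -> {poly K}) : gauss_cauchy v W ->
  gauss_cauchy v (fun n => (W n)^`()).
Proof.
move=> h e /h[N hN]; exists N => m n hm hn; rewrite -derivB.
exact: (gauss_le_deriv vA (hN _ _ hm hn)).
Qed.

Lemma gauss_cauchy_uniform (W : nat -> {poly K}) (A : set K) g :
  gauss_cauchy v W -> (forall t, A t -> v t <= 1) ->
  (forall t, A t -> vcvg v (fun n => (W n).[t]) (g t)) ->
  forall e, 0 < e -> exists N : nat, forall n t, (N <= n)%N -> A t ->
    v (g t - (W n).[t]) <= e.
Proof.
move=> cW hA hg e e0; have [N hN] := cW e e0; exists N => n t hn At.
have [M hM] := (vcvgP vA _ _).1 (hg t At) e e0.
apply: (nav_trans_le vA (y := (W (maxn N M)).[t])).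
  by rewrite navBC // hM ?leq_maxr.
rewrite -hornerN -hornerD; apply: (gauss_le_horner vA) (hA _ At).
by apply: hN; rewrite ?leq_maxl.
Qed.

Context (A : set K) (hA : forall t, A t -> v t <= 1).
Context (Y : nat -> {poly K}) (y dy : K -> K).
Context (Y_cauchy : gauss_cauchy v Y) (Y_le1 : forall n, gauss_le v 1 (Y n)).
Context (Y_cvg : forall t, A t -> vcvg v (fun n => (Y n).[t]) (y t)).
Context (dY_cvg : forall t, A t -> vcvg v (fun n => (Y n)^`().[t]) (dy t)).

Lemma limit_le1 t : A t -> v (y t) <= 1 /\ v (dy t) <= 1.
Proof.
move=> At; split; [apply: (vcvg_le vA (Y_cvg At)) | apply: (vcvg_le vA (dY_cvg At))].
  by move=> n; apply: (gauss_le_horner vA) => //; apply: hA.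
by move=> n; apply: (gauss_le_horner vA); [apply: gauss_le_deriv | apply: hA].
Qed.

(** Here [dy] is just the limit of the derivatives of the [Y n]. The set [A] is left general because
    the cofactor u = (x - a)/(t - tau) will be controlled only on points at distance 1 from tau. *)
Lemma pullback_approx P h e : gauss_le v h P -> 0 < e -> exists N : nat,
  (forall m n, (N <= m)%N -> (N <= n)%N ->
     gauss_le v e ((P \Po Y m) * (Y m)^`() - (P \Po Y n) * (Y n)^`())) /\
  (forall n t, (N <= n)%N -> A t ->
     v (P.[y t] * dy t - ((P \Po Y n) * (Y n)^`()).[t]) <= e).
Proof.
move=> hP e0; have h0 := gauss_le_ge0 vA hP.
pose d := e / (h + 1); have d0 : 0 < d by rewrite divr_gt0 // ltr_wpDl.
have hd : h * d <= e.
  rewrite mulrCA ler_piMr ?(ltW e0) // ler_pdivrMr ?mul1r ?ltr_wpDl //.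
  by rewrite lerDl.
have cY' := gauss_cauchy_deriv Y_cauchy.
have [N1 h1] := Y_cauchy d0; have [N2 h2] := cY' d d0.
have [N3 h3] := gauss_cauchy_uniform Y_cauchy hA Y_cvg d0.
have [N4 h4] := gauss_cauchy_uniform cY' hA dY_cvg d0.
have dY1 n : gauss_le v 1 (Y n)^`() by apply: gauss_le_deriv.
exists (maxn (maxn N1 N2) (maxn N3 N4)); split.
  move=> m n; rewrite !geq_max => /andP[/andP[m1 m2] _] /andP[/andP[n1 n2] _].
  have -> : (P \Po Y m) * (Y m)^`() - (P \Po Y n) * (Y n)^`() =
      ((P \Po Y m) - (P \Po Y n)) * (Y m)^`() +
      (P \Po Y n) * ((Y m)^`() - (Y n)^`()) by ring.
  apply: (gauss_leW hd); apply: gauss_leD => //.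
    rewrite -[h * d]mulr1; apply: gauss_leM => //.
    by apply: gauss_le_compB => //; apply: h1.
  by apply: gauss_leM => //; [apply: gauss_le_comp | apply: h2].
move=> n t; rewrite !geq_max => /andP[_ /andP[n3 n4]] At.
have [y1 dy1] := limit_le1 At; have t1 := hA At.
have Yt1 : v (Y n).[t] <= 1 by apply: (gauss_le_horner vA).
rewrite hornerM horner_comp.
have -> : P.[y t] * dy t - P.[(Y n).[t]] * (Y n)^`().[t] =
    (P.[y t] - P.[(Y n).[t]]) * dy t + P.[(Y n).[t]] * (dy t - (Y n)^`().[t]) by ring.
apply: (le_trans _ hd); apply: navD_le => //; rewrite navM //.
  apply: (@le_trans _ _ (v (P.[y t] - P.[(Y n).[t]]))).
    by rewrite ler_piMr ?nav_ge0.
  apply: (le_trans (horner_lipschitz vA hP y1 Yt1)).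
  by rewrite ler_wpM2l // h3.
by rewrite ler_pM ?nav_ge0 // ?h4 //; apply: (gauss_le_horner vA).
Qed.

Context (A_unity : forall n z, z ^+ (p ^ n) = 1 -> A z).

Lemma pullback_analytic P : disc_analytic p v (fun t => P.[y t] * dy t).
Proof.
move=> e e0; have [h _ hP] := gauss_le_ex vA P.
have [N [hN _]] := pullback_approx hP e0.
exists ((P \Po Y N) * (Y N)^`()) => n d d0.
have [M [_ hM]] := pullback_approx hP d0.
exists ((P \Po Y (maxn N M)) * (Y (maxn N M))^`()).
  by apply: hN; rewrite ?leq_maxl.
by move=> z /A_unity Az; apply: hM; rewrite ?leq_maxr.
Qed.

(* Expand [1 / (1 - y)] as a geometric series. *)
Lemma pullback_inv_analytic th : 0 <= th -> th < 1 ->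
  (forall n, gauss_le v th (Y n)) ->
  disc_analytic p v (fun t => (1 - y t)^-1 * dy t).
Proof.
move=> th0 th1 hth e e0.
have [N0 hN0] := geometric_small th0 th1 e0.
pose S m n : {poly K} := \sum_(m <= i < n) 'X^i.
have S1 m n : gauss_le v 1 (S m n).
  by apply: (gauss_le_sum vA) => // i _; apply: gauss_leXn.
have [N [hN _]] := pullback_approx (S1 0%N N0) e0.
exists ((S 0%N N0 \Po Y N) * (Y N)^`()) => n d d0.
have [M0 hM0] := geometric_small th0 th1 d0.
pose m0 := maxn N0 M0.
have [M [_ hM]] := pullback_approx (S1 0%N m0) d0.
pose m := maxn N M.
exists ((S 0%N m0 \Po Y m) * (Y m)^`()).
  have -> : S 0%N m0 = S 0%N N0 + S N0 m0.
    by rewrite /S -big_cat_nat //= leq_maxl.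
  rewrite rmorphD /= mulrDl addrAC; apply: gauss_leD => //.
    by apply: hN; rewrite ?leq_maxl.
  have dY1 : gauss_le v 1 (Y m)^`() by apply: gauss_le_deriv.
  rewrite -[e]mulr1; apply: gauss_leM => //.
  rewrite /S rmorph_sum /= big_seq_cond; apply: (gauss_le_sum vA); first exact: ltW.
  move=> i; rewrite andbT mem_index_iota => /andP[iN _].
  rewrite rmorphXn /= comp_polyX.
  by apply: (gauss_leW (hN0 i iN)); apply: gauss_leXn_exp.
move=> z /A_unity Az; apply: (nav_trans_le vA (y := (S 0%N m0).[y z] * dy z)); last first.
  by apply: hM => //; rewrite leq_maxr.
have yth : v (y z) <= th.
  apply: (vcvg_le vA (Y_cvg Az)) => k; apply: (gauss_le_horner vA) => //; exact: hA.
have w1 : v (1 - y z) = 1.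
  by rewrite (navDr vA) ?navN // nav1 //; apply: le_lt_trans th1.
have w0 : 1 - y z != 0 by rewrite -(nav_gt0 vA) w1.
have -> : (1 - y z)^-1 * dy z - (S 0%N m0).[y z] * dy z =
    y z ^+ m0 / (1 - y z) * dy z.
  rewrite -mulrBl; congr (_ * _); apply: (mulfI w0).
  rewrite mulrBr mulfV // mulrCA mulfV // mulr1.
  have -> : (S 0%N m0).[y z] = \sum_(i < m0) y z ^+ i.
    by rewrite /S big_mkord horner_sum; apply: eq_bigr => i _; rewrite hornerXn.
  have -> : (1 - y z) * \sum_(i < m0) y z ^+ i = 1 - y z ^+ m0.
    by rewrite -[1 - y z]opprB mulNr -subrX1 opprB.
  by rewrite opprB addrC subrK.
have [_ dy1] := limit_le1 Az.
rewrite navM // navM // navV // w1 invr1 mulr1 navX //.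
apply: (@le_trans _ _ (th ^+ m0)); last by apply: hM0; rewrite leq_maxr.
apply: (@le_trans _ _ (v (y z) ^+ m0)).
  by rewrite ler_piMr ?exprn_ge0 ?nav_ge0.
by rewrite lerXn2r // nnegrE nav_ge0.
Qed.

End GaussLimits.

(** * Convergence of the means *)

Section Core.
Context {R : realType} {p : nat} {K : fieldType} {v : K -> R}.
Context (p_prime : prime p) (KC : Cp_like p v).
Implicit Types (x y z t : K) (e d h : R) (f g : K -> K) (P Q H : {poly K}).

Let vA := Cp_abs KC.
Let vp0 : 0 < v p%:R := Cp_p_gt0 KC.
Let vp1 : v p%:R < 1 := Cp_p_lt1 KC.

Context (c : nat -> K) (G dG : K -> K).
Context (c_null : null_seq v c) (c0 : c 0%N = 0) (c1 : v (c 1%N) = 1).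
Context (c_lt1 : forall n, (1 < n)%N -> v (c n) < 1).
Context (G_cvg : forall t, v t <= 1 -> vcvg v (fun n => (trunc c n).[t]) (G t)).
Context (dG_cvg : forall t, v t <= 1 -> vcvg v (fun n => (trunc c n)^`().[t]) (dG t)).
Context (G1 : G 1 = 1).
Context (G_surj : forall y, v y <= 1 -> exists2 t, v t <= 1 & G t = y).
Context (alpha : nat).

Let c_le1 n : v (c n) <= 1.
Proof.
case: n => [|[|n]]; rewrite ?c0 ?nav0 ?c1 //.
exact/ltW/c_lt1.
Qed.

Let T_le1 n : gauss_le v 1 (trunc c n).
Proof. exact: gauss_le_trunc. Qed.

Let T_cauchy : gauss_cauchy v (trunc c) := trunc_cauchy vA c_null.

Let D x : Prop := v (x - 1) < 1.

Lemma D_le1 x : D x -> v x <= 1.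
Proof.
by move=> Dx; rewrite -(subrK 1 x); apply: navD_le => //; [apply: ltW | rewrite nav1].
Qed.

Lemma unity_D n z : z ^+ (p ^ n) = 1 -> D z.
Proof. by move=> /(unity_near1 p_prime KC); apply: near_lt1. Qed.

Lemma G_lipschitz s t : v s <= 1 -> v t <= 1 -> v (G s - G t) <= v (s - t).
Proof.
move=> s1 t1; apply: (@vcvg_le _ _ _ vA (fun n => (trunc c n).[s] - (trunc c n).[t])).
  apply/(vcvgP vA) => e e0.
  have [N hN] := (vcvgP vA _ _).1 (G_cvg s1) e e0.
  have [M hM] := (vcvgP vA _ _).1 (G_cvg t1) e e0.
  exists (maxn N M) => n; rewrite geq_max => /andP[nN nM].
  rewrite (_ : _ - _ = ((trunc c n).[s] - G s) - ((trunc c n).[t] - G t)); last by ring.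
  by apply: navB_le; [|apply: hN|apply: hM].
by move=> n; apply: le_trans (horner_lipschitz vA (T_le1 n) s1 t1) _; rewrite mul1r.
Qed.

Lemma G_near n z : z ^+ (p ^ n) = 1 -> v (G z - 1) ^+ (p ^ n) <= v p%:R.
Proof.
move=> zn; apply: le_trans (unity_near1 p_prime KC zn).
rewrite lerXn2r ?nnegrE ?nav_ge0 // -[in leLHS]G1.
by apply: G_lipschitz; rewrite ?nav1 // (nav_unity p_prime KC zn).
Qed.

Lemma G_D n z : z ^+ (p ^ n) = 1 -> D (G z).
Proof. by move=> /G_near; apply: near_lt1. Qed.

Definition mean n f := unity_mean p n f.
Definition pullback_mean n f := unity_mean p n (fun t => f (G t) * dG t).

Definition uniform_rational f := forall e, 0 < e -> exists P Q,
  (forall x, D x -> Q.[x] != 0) /\ forall x, D x -> v (f x - P.[x] / Q.[x]) <= e.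

Lemma uniform_rationalD f g : uniform_rational f -> uniform_rational g ->
  uniform_rational (fun x => f x - g x).
Proof.
move=> hf hg e e0; have [P [Q [Q0 hP]]] := hf e e0; have [P' [Q' [Q'0 hP']]] := hg e e0.
exists (P * Q' - P' * Q), (Q * Q'); split=> x Dx.
  by rewrite hornerM mulf_neq0 ?Q0 ?Q'0.
have -> : (P * Q' - P' * Q).[x] / (Q * Q').[x] = P.[x] / Q.[x] - P'.[x] / Q'.[x].
  by rewrite !hornerE; field; rewrite Q0 ?Q'0.
rewrite (_ : _ - _ = (f x - P.[x] / Q.[x]) - (g x - P'.[x] / Q'.[x])); last by ring.
by apply: navB_le => //; [apply: hP | apply: hP'].
Qed.

Lemma uniform_rational_quot P Q : (forall x, D x -> Q.[x] != 0) ->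
  uniform_rational (fun x => P.[x] / Q.[x]).
Proof.
by move=> Q0 e e0; exists P, Q; split=> // x _; rewrite subrr nav0 // ltW.
Qed.

Lemma uniform_rational_poly P : uniform_rational (fun x => P.[x]).
Proof.
move=> e e0; exists P, 1; split=> x _; first by rewrite hornerC oner_eq0.
by rewrite hornerC divr1 subrr nav0 // ltW.
Qed.

Let X1_le1 : gauss_le v 1 ('X - 1%:P).
Proof.
by apply: gauss_leB => //; [apply: gauss_leX | apply: gauss_leC; rewrite ?nav1].
Qed.

(* Both means are bounded by the sup norm on the open disc, which is what lets
   them pass to uniform limits in spite of the factor [p ^- n]. *)
Lemma mean_bounded f h n : uniform_rational f -> 0 < h ->
  (forall x, D x -> v (f x) <= h) -> v (mean n f) <= h /\ v (pullback_mean n f) <= h.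
Proof.
move=> hf h0 fh.
have approx d : 0 < d -> exists2 H, gauss_le v h H &
    forall x, v (x - 1) ^+ (p ^ n) <= v p%:R -> v (f x - H.[x - 1]) <= d.
  (* An error below [h] keeps the rational approximant itself bounded by [h]. *)
  move=> d0; pose e := Num.min d h; have e0 : 0 < e by rewrite lt_min d0.
  have [P [Q [Q0 hPQ]]] := hf e e0.
  have [|H hH HP] := @rational_approx _ _ _ _ KC P Q h n d Q0 (ltW h0) _ d0.
    move=> x Dx; rewrite -(subKr (f x) (P.[x] / Q.[x])); apply: navB_le => //.
      exact: fh.
    by apply: (le_trans (hPQ x Dx)); rewrite ge_min lexx orbT.
  exists H => // x hx; apply: (nav_trans_le vA (y := P.[x] / Q.[x])); last exact: HP.
  by apply: (le_trans (hPQ x (near_lt1 KC hx))); rewrite ge_min lexx.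
split; apply: (unity_mean_approx p_prime KC) => d d0.
  have [H hH HP] := approx d d0.
  exists (H \Po ('X - 1%:P)); first exact: gauss_le_comp.
  move=> z zn; rewrite horner_comp !hornerE; apply: HP.
  exact: (unity_near1 p_prime KC).
have [H hH HP] := approx d d0.
pose A := [set t | v t <= 1].
have A1 t : A t -> v t <= 1 by [].
pose Y n := ('X - 1%:P) \Po trunc c n.
have YE m : Y m = trunc c m - 1%:P by rewrite /Y comp_polyB comp_polyX comp_polyC.
have Y1 m : gauss_le v 1 (Y m) by apply: gauss_le_comp.
have Yc : gauss_cauchy v Y.
  move=> e e0; have [N hN] := T_cauchy e0; exists N => m k hm hk.
  have -> : Y m - Y k = trunc c m - trunc c k by rewrite !YE; ring.
  exact: hN.
have Yl t : A t -> vcvg v (fun n => (Y n).[t]) (G t - 1).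
  move=> /G_cvg /(vcvgP vA) hG; apply/(vcvgP vA) => e /hG[N hN]; exists N => m /hN.
  by rewrite YE !hornerE (_ : _ - 1 - (_ - 1) = (trunc c m).[t] - G t) //; ring.
have dYl t : A t -> vcvg v (fun n => (Y n)^`().[t]) (dG t).
  move=> /dG_cvg /(vcvgP vA) hG; apply/(vcvgP vA) => e /hG[N hN]; exists N => m /hN.
  by rewrite YE derivB derivC subr0.
have [N [_ hN]] := pullback_approx vA A1 Yc Y1 Yl dYl hH d0.
exists ((H \Po Y N) * (Y N)^`()).
  by rewrite -[h]mulr1; apply: gauss_leM => //; [apply: gauss_le_comp | apply: gauss_le_deriv].
move=> z zn; have z1 : A z by rewrite /A /= (nav_unity p_prime KC zn).
apply: (nav_trans_le vA (y := H.[G z - 1] * dG z)); last exact: hN.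
have [_ dG1] := limit_le1 vA A1 Y1 Yl dYl z1.
rewrite -mulrBl navM //; apply: le_trans (HP _ (G_near zn)).
by rewrite ler_piMr ?nav_ge0.
Qed.

Lemma mean_ext f g n : (forall x, D x -> f x = g x) ->
  mean n f = mean n g /\ pullback_mean n f = pullback_mean n g.
Proof.
move=> fg; split; apply: (unity_mean_ext p_prime KC) => z zn.
  exact/fg/(unity_D zn).
by rewrite fg //; apply: G_D zn.
Qed.

Lemma meanD f g n : mean n (fun x => f x + g x) = mean n f + mean n g /\
  pullback_mean n (fun x => f x + g x) = pullback_mean n f + pullback_mean n g.
Proof.
rewrite /mean /pullback_mean; split; first exact: (unity_meanD p_prime KC).
rewrite -(unity_meanD p_prime KC); apply: (unity_mean_ext p_prime KC) => z _.
exact: mulrDl.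
Qed.

Lemma meanZ a f n : mean n (fun x => a * f x) = a * mean n f /\
  pullback_mean n (fun x => a * f x) = a * pullback_mean n f.
Proof.
rewrite /mean /pullback_mean; split; first exact: (unity_meanZ p_prime KC).
rewrite -(unity_meanZ p_prime KC); apply: (unity_mean_ext p_prime KC) => z _.
by rewrite mulrA.
Qed.

(* Convergence of both means to a common limit along [alpha + l k], stated as
   a Cauchy condition; the rate [l] may depend on the precision [e]. *)
Definition mean_cauchy f := forall e, 0 < e -> exists l N : nat, (0 < l)%N /\
  forall j k, (N <= j)%N -> (N <= k)%N ->
    v (mean (alpha + l * j) f - mean (alpha + l * k) f) <= e /\
    v (pullback_mean (alpha + l * j) f - mean (alpha + l * j) f) <= e.

Lemma mean_cauchy_ext f g : (forall x, D x -> f x = g x) ->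
  mean_cauchy f -> mean_cauchy g.
Proof.
move=> fg hf e /hf[l [N [l0 h]]]; exists l, N; split=> // j k hj hk.
have [E1 E2] := mean_ext (alpha + l * j) fg; have [E3 _] := mean_ext (alpha + l * k) fg.
by rewrite -E1 -E2 -E3; apply: h.
Qed.

Lemma mean_cauchyD f g : mean_cauchy f -> mean_cauchy g ->
  mean_cauchy (fun x => f x + g x).
Proof.
move=> hf hg e e0; have [l [N [l0 h]]] := hf e e0; have [l' [N' [l0' h']]] := hg e e0.
(* The progression of step l l' lies in those of steps l and l'. *)
exists (l * l')%N, (maxn N N'); split; first by rewrite muln_gt0 l0.
move=> j k; rewrite !geq_max => /andP[jN jN'] /andP[kN kN'].
have big (a b m : nat) : (0 < b)%N -> (a <= m)%N -> (a <= b * m)%N by nia.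
have [h1 h2] := h (l' * j)%N (l' * k)%N (big _ _ _ l0' jN) (big _ _ _ l0' kN).
have [h3 h4] := h' (l * j)%N (l * k)%N (big _ _ _ l0 jN') (big _ _ _ l0 kN').
rewrite !mulnA in h1 h2 h3 h4; rewrite [(l' * l)%N]mulnC in h3 h4.
have [-> ->] := meanD f g (alpha + l * l' * j).
have [-> _] := meanD f g (alpha + l * l' * k).
by split; rewrite opprD addrACA; apply: navD_le.
Qed.

Lemma mean_cauchyZ a f : mean_cauchy f -> mean_cauchy (fun x => a * f x).
Proof.
move=> hf e e0; have [->|a0] := eqVneq a 0.
  exists 1%N, 0%N; split=> // j k _ _.
  have [-> ->] := meanZ 0 f (alpha + 1 * j); have [-> _] := meanZ 0 f (alpha + 1 * k).
  by rewrite !mul0r subrr nav0 // ltW.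
have va0 : 0 < v a by rewrite nav_gt0.
have [l [N [l0 h]]] := hf _ (divr_gt0 e0 va0); exists l, N; split=> // j k hj hk.
have [-> ->] := meanZ a f (alpha + l * j); have [-> _] := meanZ a f (alpha + l * k).
have scale x : v x <= e / v a -> v (a * x) <= e.
  by rewrite navM // ler_pdivlMr // mulrC.
by have [h1 h2] := h j k hj hk; split; rewrite -mulrBr; apply: scale.
Qed.

Lemma mean_cauchy_lim f :
  (forall e, 0 < e -> exists g, [/\ uniform_rational (fun x => f x - g x),
     mean_cauchy g & forall x, D x -> v (f x - g x) <= e]) -> mean_cauchy f.
Proof.
move=> H e e0; have [g [rfg hg fg]] := H e e0.
have [l [N [l0 h]]] := hg e e0; exists l, N; split=> // j k hj hk.
have B n : v (mean n f - mean n g) <= e /\ v (pullback_mean n f - pullback_mean n g) <= e.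
  have [b1 b2] := mean_bounded n rfg e0 fg.
  have [E1 E2] := meanD (fun x => f x - g x) g n.
  have [E3 E4] := @mean_ext (fun x => f x - g x + g x) f n (fun x _ => subrK _ _).
  by rewrite -E3 -E4 E1 E2 !addrK.
have [Bj Bj'] := B (alpha + l * j)%N; have [Bk _] := B (alpha + l * k)%N.
have [h1 h2] := h j k hj hk; split.
  apply: (nav_trans_le vA Bj); apply: (nav_trans_le vA h1).
  by rewrite navBC.
apply: (nav_trans_le vA Bj'); apply: (nav_trans_le vA h2).
by rewrite navBC.
Qed.

Lemma mean_cauchy_small f :
  (forall e, 0 < e -> exists N, forall n, (N <= n)%N -> v (mean n f) <= e) ->
  (forall e, 0 < e -> exists N, forall n, (N <= n)%N -> v (pullback_mean n f) <= e) ->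
  mean_cauchy f.
Proof.
move=> h1 h2 e e0; have [N hN] := h1 e e0; have [M hM] := h2 e e0.
exists 1%N, (maxn N M); split=> // j k.
rewrite !geq_max => /andP[jN jM] /andP[kN kM].
by split; apply: navB_le => //; (apply: hN || apply: hM); rewrite mul1n (leq_trans _ (leq_addl _ _)).
Qed.

(** * Means of polynomials and of simple poles *)

Let unity_le1 n z : z ^+ (p ^ n) = 1 -> v z <= 1.
Proof. by move=> /(nav_unity p_prime KC) ->. Qed.

Lemma mean_cauchy_poly P : mean_cauchy (fun x => P.[x]).
Proof.
apply: mean_cauchy_small => e e0.
  exists (size P).+1 => n hn; rewrite /mean (unity_mean_poly0 p_prime KC) ?nav0 ?ltW //.
  by apply: (leq_trans hn); apply/ltnW/ltn_expl/prime_gt1.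
have han : disc_analytic p v (fun t => P.[G t] * dG t).
  exact: (@pullback_analytic _ p _ _ vA [set t | v t <= 1] (fun t At => At)
    _ _ _ T_cauchy T_le1 G_cvg dG_cvg unity_le1).
exact: (unity_mean_analytic p_prime KC han e0).
Qed.

Let out_dist a x : 1 <= v (a - 1) -> D x -> v (x - a) = v (a - 1).
Proof.
move=> a1 Dx; have h : v (x - 1) < v (1 - a) by rewrite [ltRHS]navBC //; apply: lt_le_trans a1.
by rewrite -(subrKA 1) addrC (navDr vA h) navBC.
Qed.

Let out_neq0 a x : 1 <= v (a - 1) -> D x -> x - a != 0.
Proof.
by move=> a1 Dx; rewrite -(nav_gt0 vA) out_dist //; apply: lt_le_trans a1.
Qed.

Lemma uniform_rational_pole a : 1 <= v (a - 1) -> uniform_rational (fun x => (x - a)^-1).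
Proof.
move=> a1 e e0; exists 1, ('X - a%:P); split=> x Dx; rewrite !hornerE.
  exact: out_neq0.
by rewrite ?div1r ?mul1r subrr nav0 // ltW.
Qed.

Lemma mean_cauchy_pole_far a : 1 < v a -> mean_cauchy (fun x => (x - a)^-1).
Proof.
move=> a1; apply: mean_cauchy_lim => e e0.
have a0 : 0 < v a by apply: lt_trans a1.
have a0' : a != 0 by rewrite -(nav_gt0 vA).
have q0 : 0 <= (v a)^-1 by rewrite invr_ge0 ltW.
have q1 : (v a)^-1 < 1 by rewrite invf_lt1.
have [N hN] := geometric_small q0 q1 e0.
have aD : 1 <= v (a - 1).
  have h : v (- 1) < v a by rewrite navN // nav1.
  by rewrite (navDr vA h) ltW.
pose S : {poly K} := - \sum_(i < N) (a^-1) ^+ i.+1 *: 'X^i.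
exists (fun x => S.[x]); split.
- by apply: uniform_rationalD; [apply: uniform_rational_pole | apply: uniform_rational_poly].
- exact: mean_cauchy_poly.
move=> x Dx; have xa0 := out_neq0 aD Dx.
have xa : v (x - a) = v a.
  have h : v x < v (- a) by rewrite navN // (le_lt_trans (D_le1 Dx)).
  by rewrite addrC (navDr vA h) navN.
have -> : (x - a)^-1 - S.[x] = (x / a) ^+ N / (x - a).
  have -> : S.[x] = - (a^-1 * \sum_(i < N) (x / a) ^+ i).
    rewrite hornerN horner_sum mulr_sumr; congr (- _); apply: eq_bigr => i _.
    by rewrite !hornerE exprMn exprS; ring.
  have E := subrX1 (x / a) N; set T := \sum_(i < N) _ in E *.
  have -> : (x / a) ^+ N = (x / a - 1) * T + 1 by rewrite -E subrK.
  by field; rewrite xa0.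
rewrite navM // navV // xa navX //.
apply: (@le_trans _ _ ((v a)^-1 ^+ N)); last exact: hN.
rewrite ler_pdivrMr //; apply: (@le_trans _ _ ((v a)^-1 ^+ N)).
  rewrite lerXn2r // ?nnegrE ?nav_ge0 // navM // navV // ler_piMl //.
  exact: D_le1.
by rewrite ler_peMr ?exprn_ge0 // ltW.
Qed.

Lemma frobenius_orbit a l j : v a <= 1 ->
  v (a ^+ (p ^ (l * j)) - a) <= v (a ^+ (p ^ l) - a).
Proof.
move=> a1; elim: j => [|j IH]; first by rewrite muln0 expn0 expr1 subrr nav0 ?nav_ge0.
rewrite mulnS expnD exprM.
apply: (nav_trans_le vA (y := a ^+ (p ^ (l * j)))) IH.
by apply: nav_subX => //; apply: navX_le1.
Qed.

(** Up to sign, 1 - a^(p^n) is congruent to (a - 1)^(p^n) modulo p. The pole means are thus inverses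
    of units, and inversion preserves distances between units. *)
Lemma nav_1subX a n : v a <= 1 -> v (a - 1) = 1 -> v (1 - a ^+ (p ^ n)) = 1.
Proof.
move=> a1 ha; have := @nav_frobenius_iter _ _ _ vA _ p_prime a 1 n a1.
rewrite nav1 // expr1n => /(_ (lexx _)) h.
rewrite navBC // (nav_eq_of_dist vA (y := (a - 1) ^+ (p ^ n))).
  by rewrite navX // ha expr1n.
by rewrite navX // ha expr1n; apply: le_lt_trans vp1.
Qed.

Lemma mean_pole_near a n : v a <= 1 -> v (a - 1) = 1 ->
  unity_mean p n (fun z => (z - a)^-1) = (1 - a ^+ (p ^ n))^-1.
Proof.
move=> a1 ha; apply: (unity_mean_pole p_prime KC).
by rewrite eq_sym -subr_eq0 -(nav_gt0 vA) nav_1subX.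
Qed.

Lemma inv_unit_dist x y : v x = 1 -> v y = 1 -> v (x^-1 - y^-1) = v (x - y).
Proof.
move=> x1 y1; have x0 : x != 0 by rewrite -(nav_gt0 vA) x1.
have y0 : y != 0 by rewrite -(nav_gt0 vA) y1.
have -> : x^-1 - y^-1 = (y - x) / (x * y) by field; rewrite x0 y0.
by rewrite !navM // navV // navM // x1 y1 mulr1 invr1 mulr1 navBC.
Qed.

(** All terms beyond the linear one are bounded by some th < 1, and G(1) = 1 then forces c_1 = 1 in
    the residue field. Hence a point and its image have the same residue. *)
Lemma G_almost_identity : exists th, [/\ 0 <= th, th < 1,
  forall n, (1 < n)%N -> v (c n) <= th & forall t, v t <= 1 -> v (G t - t) <= th].
Proof.
have [th [th0 th1 hth]] := null_seq_le c_null c_lt1.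
have lin t : v t <= 1 -> v (G t - c 1%N * t) <= th.
  move=> t1; apply: (@vcvg_le _ _ _ vA (fun n => (trunc c n.+2).[t] - c 1%N * t)).
    apply/(vcvgP vA) => e e0; have [N hN] := (vcvgP vA _ _).1 (G_cvg t1) e e0.
    exists N => n Nn; rewrite opprB addrA subrK hN //.
    by apply: leq_trans Nn _; rewrite -addn2 leq_addr.
  move=> n; rewrite horner_trunc big_nat_recl // big_nat_recl // c0 mul0r add0r expr1.
  rewrite addrC addKr; apply: (nav_sum vA) => // i _; rewrite navM //.
  apply: (le_trans _ (hth i.+2 isT)); rewrite ler_piMr ?nav_ge0 //; exact: navX_le1.
exists th; split=> // t t1; apply: (nav_trans_le vA (lin t t1)).
rewrite -{2}[t]mul1r -mulrBl navM //; apply: (@le_trans _ _ (v (c 1%N - 1))).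
  by rewrite ler_piMr ?nav_ge0.
by rewrite navBC // -[in leLHS]G1 -[c 1%N]mulr1; apply: lin; rewrite nav1.
Qed.

(* With [tau] the preimage of [a], [G z - a = (z - tau) u z] with [u] close to
   the constant [c 1], so [G' / (G - a)] is [1 / (z - tau)] plus the
   logarithmic derivative of [u], which is analytic on the closed disc. *)
Lemma pullback_mean_pole a : v a <= 1 -> v (a - 1) = 1 ->
  forall e, 0 < e -> exists N, forall n, (N <= n)%N ->
    v (pullback_mean n (fun x => (x - a)^-1) - mean n (fun x => (x - a)^-1)) <= e.
Proof.
move=> a1 ha e e0.
have [tau tau1 Gtau] := G_surj a1.
have [th [th0 th1 cth Gth]] := G_almost_identity.
have taua : v (tau - a) <= th by rewrite navBC // -Gtau; apply: Gth.
have htau : v (tau - 1) = 1.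
  by rewrite (nav_eq_of_dist vA (y := a - 1)) // ha opprB addrA subrK (le_lt_trans taua).
have [U [UE Uc Ucoef]] := quotient_seq KC tau1 c_null.
have Ucoef1 n i : v (U n)`_i <= 1.
  by apply: (Ucoef 1 0%N) => // k _.
have Uth n i : (0 < i)%N -> v (U n)`_i <= th.
  by move=> i0; apply: (Ucoef th 1%N).
have U0 n : v ((U n.+2)`_0 - c 1%N) <= th.
  have := congr1 (fun P : {poly K} => P`_1) (UE n.+2).
  rewrite coefB coefC subr0 coef_trunc /= mulrBr coefB coefMX coefMC /= => ->.
  rewrite opprB addrC subrK navM //; apply: le_trans (Uth n.+2 1%N isT).
  by rewrite ler_piMr ?nav_ge0.
pose b := (c 1%N)^-1; have b1 : v b = 1 by rewrite navV // c1 invr1.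
(* Normalised by [b], the quotient is 1 up to [th], as a geometric expansion of its inverse
   requires. The shift by 2 ensures that the truncation contains the linear term. *)
pose Y n : {poly K} := 1 - b *: U n.+2.
have Yth n : gauss_le v th (Y n).
  move=> i; have -> : (Y n)`_i = b * ((c 1%N)%:P - U n.+2)`_i.
    rewrite /Y !coefB coef1 coefZ coefC mulrBr; congr (_ - _).
    by case: i => [|i] /=; rewrite ?mulr0 // mulVf // -(nav_gt0 vA) c1.
  rewrite navM // b1 mul1r coefB coefC; case: i => [|i]; first by rewrite navBC.
  by rewrite sub0r navN //; apply: Uth.
have Y1 n : gauss_le v 1 (Y n) by apply: gauss_leW (Yth n); apply: ltW.
have Yc : gauss_cauchy v Y.
  move=> d d0; have [N hN] := Uc d d0; exists N => m n hm hn.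
  have -> : Y m - Y n = b *: (U n.+2 - U m.+2).
    by rewrite /Y scalerBr opprB addrC addrA subrK.
  apply: gauss_leZ => //; first by rewrite b1.
  by apply: hN; apply: leqW; apply: leqW.
pose A := [set t | v t <= 1 /\ v (t - tau) = 1].
have A1 t : A t -> v t <= 1 by case.
have A_unity n z : z ^+ (p ^ n) = 1 -> A z.
  move=> zn; split; first exact: unity_le1 zn.
  by rewrite out_dist ?htau //; apply: unity_D zn.
have [u uE] : exists u : K -> K, forall t, u t = (G t - a) / (t - tau).
  by exists (fun t => (G t - a) / (t - tau)).
(* Obtained by solving the product rule dG = u + (t - tau) du. *)
have [du duE] : exists du : K -> K, forall t, du t = (dG t - u t) / (t - tau).
  by exists (fun t => (dG t - u t) / (t - tau)).
have A0 t : A t -> t - tau != 0 by case=> _ h; rewrite -(nav_gt0 vA) h.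
have U_cvg t : A t -> forall d, 0 < d -> exists N, forall n, (N <= n)%N ->
    v ((U n).[t] - u t) <= d.
  move=> At d d0; have [t1 tt] := At.
  have [N hN] := (vcvgP vA _ _).1 (G_cvg t1) d d0.
  have [M hM] := (vcvgP vA _ _).1 (G_cvg tau1) d d0.
  exists (maxn N M) => n; rewrite geq_max => /andP[nN nM].
  rewrite -[v _]mulr1 -tt -navM // mulrBl uE divfK ?A0 //.
  have := congr1 (fun P : {poly K} => P.[t]) (UE n); rewrite !hornerE => <-.
  rewrite (_ : _ - _ = ((trunc c n).[t] - G t) - ((trunc c n).[tau] - G tau)).
    by apply: navB_le; [|apply: hN|apply: hM].
  by rewrite Gtau; ring.
have Y_cvg t : A t -> vcvg v (fun n => (Y n).[t]) (1 - b * u t).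
  move=> At; apply/(vcvgP vA) => d d0; have [N hN] := U_cvg t At d d0.
  exists N => n hn; rewrite /Y !hornerE.
  have E x y : 1 - x - (1 - y) = y - x by ring.
  by rewrite E -mulrBr navM // b1 mul1r navBC // hN // leqW // leqW.
have dY_cvg t : A t -> vcvg v (fun n => (Y n)^`().[t]) (- b * du t).
  move=> At; apply/(vcvgP vA) => d d0; have [N hN] := U_cvg t At d d0.
  have [t1 tt] := At.
  have [M hM] := (vcvgP vA _ _).1 (dG_cvg t1) d d0.
  exists (maxn N M) => n; rewrite geq_max => /andP[nN nM].
  rewrite /Y derivB derivZ -polyC1 derivC sub0r !hornerE.
  rewrite mulNr opprK addrC -mulrBr navM // b1 mul1r navBC // -[v _]mulr1 -tt -navM // mulrBl duE divfK ?A0 //.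
  have := congr1 (fun P : {poly K} => P^`().[t]) (UE n.+2).
  rewrite derivB derivC subr0 derivM derivXsubC mulr1 !hornerE => E.
  rewrite (_ : _ - _ = ((trunc c n.+2)^`().[t] - dG t) - ((U n.+2).[t] - u t)).
    by apply: (navB_le vA); [apply: hM|apply: hN]; apply: leqW; apply: leqW.
  by rewrite E; ring.
have an := pullback_inv_analytic vA A1 Yc Y1 Y_cvg dY_cvg A_unity th0 th1 Yth.
have [N hN] := unity_mean_analytic p_prime KC an e0.
have m0 : th <= Num.max th (v p%:R) by rewrite le_max lexx.
have m1 : v p%:R <= Num.max th (v p%:R) by rewrite le_max lexx orbT.
have [||M hM] := @geometric_small R (Num.max th (v p%:R)) _ _ e e0.
- by rewrite le_max th0.
- by rewrite gt_max th1.
exists (maxn N M) => n; rewrite geq_max => /andP[nN nM].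
have -> : pullback_mean n (fun x => (x - a)^-1) =
   unity_mean p n (fun z => (z - tau)^-1) - unity_mean p n (fun t => (1 - (1 - b * u t))^-1 * (- b * du t)).
  rewrite -(unity_meanB p_prime KC); apply: (unity_mean_ext p_prime KC) => z zn.
  have Az := A_unity n z zn; have z0 := A0 z Az.
  have Ga : G z - a != 0.
    apply: out_neq0; first by rewrite ha.
    exact: G_D zn.
  have b0 : b != 0 by rewrite -(nav_gt0 vA) b1.
  have u0 : u z != 0 by rewrite uE mulf_neq0 // invr_neq0.
  rewrite subKr.
  have -> : dG z = du z * (z - tau) + u z by rewrite duE divfK // subrK.
  have -> : G z - a = u z * (z - tau) by rewrite uE divfK.
  by field; rewrite z0 u0 b0.
(* What remains of the poles is 1/(1 - tau^(p^n)) - 1/(1 - a^(p^n)), which tends to 0 because tau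
   and a have the same residue. *)
rewrite mean_pole_near // /mean mean_pole_near // addrAC; apply: navB_le => //.
  rewrite inv_unit_dist ?nav_1subX //.
  rewrite (_ : _ - _ = a ^+ (p ^ n) - tau ^+ (p ^ n)); last by ring.
  apply: (le_trans (nav_contract_iter vA n a1 tau1 (e := Num.max th (v p%:R)) _ m1 _)).
  - by rewrite navBC //; apply: le_trans m0.
  - by rewrite ge_max !ltW.
  - by apply: hM; apply: leqW.
exact: hN.
Qed.

Lemma mean_cauchy_pole a : 1 <= v (a - 1) -> mean_cauchy (fun x => (x - a)^-1).
Proof.
move=> aD; have [a1|a1] := ltP 1 (v a); first exact: mean_cauchy_pole_far.
have ha : v (a - 1) = 1 by apply/eqP; rewrite eq_le aD navB_le ?nav1.
move=> e e0; have [N1 hN1] := pullback_mean_pole a1 ha e0.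
have [l l0 hl] := Cp_residue KC a1.
pose th := Num.max (v (a ^+ (p ^ l) - a)) (v p%:R).
have th0 : 0 <= th by rewrite le_max nav_ge0.
have th1 : th < 1 by rewrite gt_max hl.
have pth : v p%:R <= th by rewrite le_max lexx orbT.
have [N2 hN2] := geometric_small th0 th1 e0.
exists l, (maxn N1 N2); split=> // j k.
rewrite !geq_max => /andP[j1 j2] /andP[k1 k2]; split; last first.
  by apply: hN1; nia.
rewrite /mean !mean_pole_near // inv_unit_dist ?nav_1subX //.
have key i i' : (N2 <= i)%N -> (i <= i')%N ->
    v (1 - a ^+ (p ^ (alpha + l * i)) - (1 - a ^+ (p ^ (alpha + l * i')))) <= e.
  (* The later power is b^(p^(alpha + l i)) with b = a^(p^(l (i' - i))), and b has the residue of a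
     by the choice of l. *)
  move=> i2 ii'; rewrite -(subnKC ii') mulnDr addnA [in X in _ - X]expnD.
  rewrite [(p ^ _ * _)%N in X in _ - X]mulnC exprM.
  set b := a ^+ (p ^ (l * (i' - i))).
  rewrite (_ : _ - _ = b ^+ (p ^ (alpha + l * i)) - a ^+ (p ^ (alpha + l * i))); last by ring.
  apply: (le_trans (nav_contract_iter vA _ (e := th) _ a1 _ pth (ltW th1))).
  - exact: navX_le1.
  - by apply: le_trans (frobenius_orbit _ _ a1) _; rewrite le_max lexx.
  - by apply: hN2; nia.
have [jk|/ltnW kj] := leqP j k; first exact: key.
by rewrite navBC //; apply: key.
Qed.

(** Induction on the number of poles: two distinct poles are separated by 1/((x - a)(x - b)) = (1/(x
    - a) - 1/(x - b))/(a - b), and two equal ones are the uniform limit of the pair a + d, a. *)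
Lemma mean_cauchy_rational (s : seq K) P : (forall a, a \in s -> 1 <= v (a - 1)) ->
  mean_cauchy (fun x => P.[x] / \prod_(a <- s) (x - a)).
Proof.
have [n] := ubnP (size s); elim: n s P => // n IH [|a [|b s]] P hn hs.
- apply: mean_cauchy_ext (mean_cauchy_poly P) => x _.
  by rewrite big_nil divr1.
- have aD : 1 <= v (a - 1) by apply: hs; rewrite inE eqxx.
  have /factor_theorem[Q QE] : root (P - P.[a]%:P) a by apply/rootP; rewrite !hornerE subrr.
  apply: mean_cauchy_ext (mean_cauchyD (mean_cauchy_poly Q)
    (mean_cauchyZ P.[a] (mean_cauchy_pole aD))) => x Dx.
  have xa := out_neq0 aD Dx; rewrite big_seq1.
  have -> : P = Q * ('X - a%:P) + P.[a]%:P by rewrite -QE subrK.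
  by rewrite !hornerE subrr mulr0 add0r; field.
have aD : 1 <= v (a - 1) by apply: hs; rewrite inE eqxx.
have bD : 1 <= v (b - 1) by apply: hs; rewrite !inE eqxx orbT.
have sD (d : K) : d \in s -> 1 <= v (d - 1) by move=> ds; apply: hs; rewrite !inE ds !orbT.
have split2 a' : 1 <= v (a' - 1) -> a' != b ->
    mean_cauchy (fun x => P.[x] / \prod_(a <- [:: a', b & s]) (x - a)).
  move=> a'D ab.
  have ha : mean_cauchy (fun x => P.[x] / \prod_(a <- a' :: s) (x - a)).
    by apply: IH => // d; rewrite inE => /orP[/eqP->|/sD].
  have hb : mean_cauchy (fun x => P.[x] / \prod_(a <- b :: s) (x - a)).
    by apply: IH => // d; rewrite inE => /orP[/eqP->|/sD].
  apply: mean_cauchy_ext (mean_cauchyZ (a' - b)^-1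
    (mean_cauchyD ha (mean_cauchyZ (-1) hb))) => x Dx.
  have xa := out_neq0 a'D Dx; have xb := out_neq0 bD Dx.
  rewrite !big_cons; set S := \prod_(_ <- s) _.
  have S0 : S != 0.
    by rewrite prodf_seq_neq0; apply/allP => d ds /=; apply: out_neq0 (sD d ds) Dx.
  by field; rewrite xa xb S0 subr_eq0.
have [ab|ab] := eqVneq a b; last exact: split2.
subst b; apply: mean_cauchy_lim => e e0.
have [B B0 hB] := gauss_le_ex vA P.
(* The bound 1 keeps [a + d] outside the open disc, and [e / B] controls the perturbation, whose
   other factors have size at most 1. *)
have [|d d0 hd] := nav_small_exists KC (e := Num.min 1 (e / B)).
  by rewrite lt_min ltr01 divr_gt0.
have [d1 de] : v d < 1 /\ v d < e / B by apply/andP; rewrite -lt_min.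
have adD : 1 <= v (a + d - 1).
  by rewrite addrAC navDr // (lt_le_trans d1).
have neq : a + d != a by rewrite -subr_eq0 addrAC subrr add0r.
exists (fun x => P.[x] / \prod_(a <- [:: a + d, a & s]) (x - a)); split.
- have hr (s' : seq K) : (forall b, b \in s' -> 1 <= v (b - 1)) ->
      uniform_rational (fun x => P.[x] / \prod_(a <- s') (x - a)).
    move=> hs' h h0; exists P, (\prod_(a <- s') ('X - a%:P)).
    have E x : (\prod_(a <- s') ('X - a%:P)).[x] = \prod_(a <- s') (x - a).
      by rewrite horner_prod; apply: eq_bigr => b _; rewrite !hornerE.
    split=> x Dx; rewrite E.
      by rewrite prodf_seq_neq0; apply/allP => b bs /=; apply: out_neq0 (hs' b bs) Dx.
    by rewrite subrr nav0 // ltW.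
  apply: uniform_rationalD; apply: hr => // b; rewrite !inE.
  by case/or3P => [/eqP->|/eqP->|/sD].
- exact: split2.
move=> x Dx; rewrite !big_cons; set S := \prod_(_ <- s) _.
have xa := out_neq0 aD Dx; have xad := out_neq0 adD Dx.
have S1 : v S^-1 <= 1.
  rewrite -prodfV; rewrite big_seq_cond; apply: (nav_prod_le1 vA) => b.
  rewrite andbT => bs; rewrite navV // out_dist ?sD // invf_le1 ?sD //.
  by apply: lt_le_trans (sD b bs).
have S0 : S != 0.
  by rewrite prodf_seq_neq0; apply/allP => b bs /=; apply: out_neq0 (sD b bs) Dx.
have xa1 : v (x - a)^-1 <= 1.
  by rewrite navV // out_dist // invf_le1 // (lt_le_trans ltr01).
have xad1 : v (x - (a + d))^-1 <= 1.
  by rewrite navV // out_dist // invf_le1 // (lt_le_trans ltr01).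
have -> : P.[x] / ((x - a) * ((x - a) * S)) - P.[x] / ((x - (a + d)) * ((x - a) * S)) =
    (P.[x] * - d) * ((x - a)^-1 * ((x - a)^-1 * ((x - (a + d))^-1 * S^-1))).
  by field; rewrite xa S0 xad.
rewrite navM //; apply: (@le_trans _ _ (v (P.[x] * - d))).
  by rewrite ler_piMr ?nav_ge0 //; do ![apply: navM_le1 => //].
rewrite navM // navN //; apply: (@le_trans _ _ (B * v d)).
  by rewrite ler_wpM2r ?nav_ge0 //; apply: (gauss_le_horner vA hB (D_le1 Dx)).
by rewrite mulrC -ler_pdivlMr // ltW.
Qed.

Lemma mean_cauchy_krasner f : uniform_rational f -> mean_cauchy f.
Proof.
move=> hf; apply: mean_cauchy_lim => e e0; have [P [Q [Q0 hPQ]]] := hf e e0.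
exists (fun x => P.[x] / Q.[x]); split=> //.
  by apply: uniform_rationalD => //; apply: uniform_rational_quot.
have [s sE] := splits_of_roots (Cp_roots KC) Q.
have D1 : D 1 by rewrite /D subrr nav0.
have l0 : lead_coef Q != 0.
  by rewrite lead_coef_eq0; apply: contraNneq (Q0 1 D1) => ->; rewrite horner0.
have hs a : a \in s -> 1 <= v (a - 1).
  move=> sa; rewrite leNgt; apply/negP => /Q0.
  by rewrite sE hornerZ mulf_eq0 negb_or -[_.[a] == 0]/(root _ a) root_prod_XsubC sa andbF.
apply: mean_cauchy_ext (mean_cauchyZ (lead_coef Q)^-1 (mean_cauchy_rational P hs)) => x Dx.
rewrite [in RHS]sE hornerZ horner_prod invfM mulrCA; congr (_ * (_ * _^-1)).
by apply: eq_bigr => a _; rewrite !hornerE.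
Qed.

Lemma means_converge f : uniform_rational f -> exists L, forall e, 0 < e ->
  exists l N : nat, (0 < l)%N /\ forall k, (N <= k)%N ->
    v (mean (alpha + l * k) f - L) <= e /\ v (pullback_mean (alpha + l * k) f - L) <= e.
Proof.
move=> /mean_cauchy_krasner hf.
pose h n : R := 2^-1 ^+ n; have h0 n : 0 < h n by rewrite exprn_gt0 // invr_gt0.
have [l /choice[N lN]] := choice (fun n => hf (h n) (h0 n)).
pose u n := mean (alpha + l n * N n) f.
have hsmall e : 0 < e -> exists M, forall n, (M <= n)%N -> h n <= e.
  by apply: geometric_small; rewrite ?invr_ge0 ?invf_lt1 ?ltr1n.
have udist n m : v (u n - u m) <= Num.max (h n) (h m).
  have [ln hn] := lN n; have [lm hm] := lN m.
  (* Samples taken at rates l_n and l_m are compared at the index l_n l_m k, which belongs to both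
     progressions. *)
  pose k := (N n + N m)%N.
  have [h1 _] := hn (N n) (l m * k)%N (leqnn _) ltac:(rewrite /k; nia).
  have [h2 _] := hm (N m) (l n * k)%N (leqnn _) ltac:(rewrite /k; nia).
  apply: (nav_trans_le vA (y := mean (alpha + l n * (l m * k)) f)).
    by apply: (le_trans h1); rewrite le_max lexx.
  rewrite navBC // mulnCA; apply: (le_trans h2).
  by rewrite le_max lexx orbT.
have [L hL] : exists L, vcvg v u L.
  apply: (vcvg_of_cauchy_le (Cp_complete KC)) => e /hsmall[M hM].
  exists M => m n Mm Mn; apply: le_trans (udist _ _) _.
  by rewrite ge_max !hM.
exists L => e e0; have [M1 hM1] := (vcvgP vA _ _).1 hL e e0.
have [M2 hM2] := hsmall e e0; pose n := maxn M1 M2.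
have uL : v (u n - L) <= e by apply: hM1; apply: leq_maxl.
have hn : h n <= e by apply: hM2; apply: leq_maxr.
have [ln Hn] := lN n; exists (l n), (N n); split=> // k Nk.
have [h1 h2] := Hn k (N n) Nk (leqnn _).
have A1 : v (mean (alpha + l n * k) f - L) <= e.
  by apply: (nav_trans_le vA _ uL); apply: le_trans h1 hn.
split=> //; apply: (nav_trans_le vA _ A1); exact: le_trans h2 hn.
Qed.

End Core.

(** * Reduction to the unit discs *)

Section Limits.
Context {R : realType} {p : nat} {K : fieldType} {v : K -> R} (KC : Cp_like p v).
Implicit Types (x y t l : K) (e : R) (u w : nat -> K).

Let vA := Cp_abs KC.

Lemma vcvgD u w l l' : vcvg v u l -> vcvg v w l' ->
  vcvg v (fun n => u n + w n) (l + l').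
Proof.
move=> /(vcvgP vA) hu /(vcvgP vA) hw; apply/(vcvgP vA) => e e0.
have [N hN] := hu e e0; have [M hM] := hw e e0.
exists (maxn N M) => n; rewrite geq_max => /andP[nN nM].
by rewrite opprD addrACA; apply: navD_le => //; [apply: hN | apply: hM].
Qed.

Lemma vcvgZ y u l : vcvg v u l -> vcvg v (fun n => y * u n) (y * l).
Proof.
move=> /(vcvgP vA) hu; apply/(vcvgP vA) => e e0.
have [->|y0] := eqVneq y 0; first by exists 0%N => n _; rewrite !mul0r subrr nav0 // ltW.
have vy : 0 < v y by rewrite nav_gt0.
have [N hN] := hu _ (divr_gt0 e0 vy); exists N => n /hN.
by rewrite -mulrBr navM // ler_pdivlMr // mulrC.
Qed.

Lemma vcvg_ext u w l (m : nat) : (forall n, (m <= n)%N -> u n = w n) ->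
  vcvg v u l -> vcvg v w l.
Proof.
move=> uw /(vcvgP vA) h; apply/(vcvgP vA) => e /h[N hN].
exists (maxn m N) => n; rewrite geq_max => /andP[mn Nn].
by rewrite -uw // hN.
Qed.

Lemma vcvg_cst l : vcvg v (fun=> l) l.
Proof. by apply/(vcvgP vA) => e e0; exists 0%N => n _; rewrite subrr nav0 // ltW. Qed.

Lemma vcvg_nav_eq u l r (m : nat) : 0 < r -> (forall n, (m <= n)%N -> v (u n) = r) ->
  vcvg v u l -> v l = r.
Proof.
move=> r0 ur /(vcvgP vA) h; have [N hN] := h _ (divr_gt0 r0 (ltr0Sn R 1)).
have := hN (maxn m N) (leq_maxr _ _); have := ur (maxn m N) (leq_maxl _ _).
set y := u _ => yr yl; rewrite -yr; apply: (nav_eq_of_dist vA).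
by rewrite navBC // yr (le_lt_trans yl) // ltr_pdivrMr // ltr_pMr // ltr1n.
Qed.

Lemma series_terms_null w (l : K) : vcvg v (fun n => \sum_(0 <= i < n) w i) l ->
  null_seq v w.
Proof.
move=> /(vcvgP vA) h e /h[N hN]; exists N => n Nn.
have -> : w n = (\sum_(0 <= i < n.+1) w i - l) - (\sum_(0 <= i < n) w i - l).
  by rewrite big_nat_recr //=; ring.
by apply: navB_le => //; apply: hN => //; apply: leqW.
Qed.

(** With P - P(t) = (X - t) U, the left side is k (U(t + k) - U(t)), and U is 1-Lipschitz. The bound
    is uniform in P, so it passes to limits of truncations and yields the derivative of x. *)
Lemma difference_quotient P t k : gauss_le v 1 P -> v t <= 1 -> v k <= 1 ->
  v (P.[t + k] - P.[t] - k * P^`().[t]) <= v k * v k.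
Proof.
move=> P1 t1 k1; have /factor_theorem[U UE] : root (P - P.[t]%:P) t.
  by apply/rootP; rewrite !hornerE subrr.
have U1 : gauss_le v 1 U.
  move=> i; apply: (gauss_le_divX vA (m := 0) t1 ler01 UE) => // {}i i0.
  by rewrite coefB coefC gtn_eqF // subr0.
have PE y : P.[y] - P.[t] = U.[y] * (y - t).
  by have := congr1 (fun Q : {poly K} => Q.[y]) UE; rewrite !hornerE.
have -> : P^`().[t] = U.[t].
  have := congr1 (fun Q : {poly K} => Q^`().[t]) UE.
  by rewrite derivB derivC subr0 derivM derivXsubC mulr1 !hornerE subrr mulr0 add0r.
rewrite PE (_ : t + k - t = k); last by ring.
rewrite [U.[_] * k]mulrC -mulrBr navM // ler_wpM2l ?nav_ge0 //.
apply: (le_trans (horner_lipschitz vA U1 _ t1)); first exact: navD_le.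
by rewrite mul1r (_ : t + k - t = k) //; ring.
Qed.

Lemma is_vderiv_unique (g : K -> K) t d d' :
  is_vderiv v g t d -> is_vderiv v g t d' -> d = d'.
Proof.
move=> h h'; apply/eqP; rewrite -subr_eq0; apply/eqP/(nav_small_eq0 vA) => e e0.
have [s s0 hs] := h e e0; have [s' s'0 hs'] := h' e e0.
have [|k k0 kk] := nav_small_exists KC (e := Num.min s s'); first by rewrite lt_min s0.
move: kk; rewrite lt_min => /andP[ks ks'].
apply: (nav_trans_le vA (y := (g (t + k) - g t) / k)); last exact/ltW/hs'.
by rewrite navBC //; apply/ltW/hs.
Qed.

Lemma vderiv_eq (g : K -> K) t d : is_vderiv v g t d -> vderiv v g t = d.
Proof.
move=> h; apply: is_vderiv_unique (h).
exact: (@xgetPex _ 0 [set d | is_vderiv v g t d]) (ex_intro _ d h).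
Qed.

End Limits.

Theorem theorem4p11 (R : realType) (p : nat) (C : fieldType) (v : C -> R)
    (p_prime : prime p) (p_odd : odd p) (C_Cp : is_Cp p v)
    (a b : C) (a_neq_b : a != b) (r : R) (r_def : r = v (a - b))
    (f : C -> C) (f_krasner : krasner_analytic v (arc v a b) f)
    (a1 : C) (rho : R) (rho_gt0 : 0 < rho) (x : C -> C)
    (x_holo : holomorphic_on_disc v a1 rho x)
    (x_bij : set_bij (closed_disc v a1 rho) (closed_disc v a r) x)
    (x_a1 : x a1 = a)
    (b1 : C) (b1_disc : closed_disc v a1 rho b1) (x_b1 : x b1 = b)
    (alpha : nat) :
  exists L : C,
    has_arc_integral v p a b (Phi_ alpha%:Z) f L /\
    has_arc_integral v p a1 b1 (Phi_ alpha%:Z)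
      (fun t => f (x t) * vderiv v x t) L.
Proof.
have KC := is_Cp_like p_prime C_Cp; have vA := Cp_abs KC.
have [u hu] := x_holo; have [x_fun x_inj x_surj] := x_bij.
pose be := b1 - a1; pose de := b - a.
have de0 : de != 0 by rewrite subr_eq0 eq_sym.
have be0 : be != 0.
  by rewrite subr_eq0; apply: contraNneq a_neq_b => E; rewrite -x_a1 -x_b1 E.
have vde : 0 < v de by rewrite nav_gt0.
have vbe : 0 < v be by rewrite nav_gt0.
have rE : r = v de by rewrite r_def navBC.
have discP s t : v s <= rho -> v t <= 1 -> closed_disc v a1 rho (a1 + s * t).
  move=> hs ht; rewrite /closed_disc /= addrC addKr navM //.
  by apply: le_trans hs; rewrite ler_piMr ?nav_ge0.
have u0 : u 0%N = a.
  have := hu a1; rewrite /closed_disc /= subrr nav0 // => /(_ (ltW rho_gt0)).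
  rewrite x_a1; apply: (vcvg_unique vA).
  apply: (vcvg_ext KC (m := 1) _ (vcvg_cst KC (u 0%N))) => -[//|n] _.
  by rewrite big_nat_recl // expr0 mulr1 big1 ?addr0 // => i _; rewrite exprS mul0r mulr0.
(* The radius [rho] need not be an absolute value. Rescaling by each [s] of the disc puts the series
   on the closed unit disc, where the dominance of the linear term was proved. *)
pose cs s (n : nat) := u n * s ^+ n.
have cs_cvg s t : v s <= rho -> v t <= 1 ->
    vcvg v (fun n => (trunc (cs s) n).[t]) (x (a1 + s * t)).
  move=> hs ht; have := hu _ (discP s t hs ht).
  apply: (vcvg_ext KC (m := 0)) => n _; rewrite horner_trunc.
  by apply: eq_bigr => i _; rewrite addrC addKr exprMn mulrA.
have cs_null s : v s <= rho -> null_seq v (cs s).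
  move=> hs; have := cs_cvg s 1 hs; rewrite nav1 // => /(_ (lexx _)) h.
  apply: (series_terms_null KC (l := x (a1 + s * 1))); apply: (vcvg_ext KC (m := 0)) h => n _.
  by rewrite horner_trunc; apply: eq_bigr => i _; rewrite expr1n mulr1.
have dom s : s != 0 -> v s <= rho ->
    cs s 1%N != 0 /\ forall n, (1 < n)%N -> v (cs s n) < v (cs s 1%N).
  move=> s0 hs; apply: (injective_series_dominant KC (cs_null s hs)
    (fun t ht => cs_cvg s t hs ht)) => t t' ht ht' E.
  apply: (mulfI s0); apply: (addrI a1).
  by apply: x_inj => //; rewrite inE; apply: discP.
have linear s : s != 0 -> v s <= rho -> v (x (a1 + s) - a) = v (u 1%N * s).
  move=> s0 hs; have [c1 clt] := dom s s0 hs.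
  have h := cs_cvg s 1 hs; rewrite nav1 // mulr1 in h.
  have {}h := vcvgD KC (h (lexx _)) (vcvg_cst KC (- a)).
  apply: (vcvg_nav_eq KC (m := 2) _ _ h); first by rewrite -[s]expr1 nav_gt0.
  move=> [|[//|n]] // _; rewrite horner_trunc big_nat_recl // big_nat_recl //.
  rewrite /cs u0 !expr0 !mulr1 addrAC subrr add0r ?expr1 ?mulr1.
  rewrite navDr //; apply: (nav_sum_lt vA); first by rewrite -[s]expr1 nav_gt0.
  move=> i _; rewrite expr1n mulr1 -[s in X in _ < X]expr1.
  exact: clt.
have a1be : a1 + be = b1 by rewrite addrC subrK.
have u1be : v (u 1%N * be) = v de by rewrite -linear // a1be x_b1.
(* By [linear], distances to the center are multiplied by |u_1|, and images stay within |de| = |u_1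
   be|. The disc thus contains no point beyond |be|, so surjectivity survives the rescaling by
   [be]. *)
have disc_small t : closed_disc v a1 rho t -> v (t - a1) <= v be.
  move=> ht; have [->|t0] := eqVneq (t - a1) 0; first by rewrite nav0 // ltW.
  have := linear _ t0 ht; rewrite [a1 + _]addrC subrK => E.
  have : v (x t - a) <= r := x_fun t ht.
  rewrite E rE -u1be !navM // ler_pM2l // nav_gt0 //.
  have [+ _] := dom be be0 b1_disc; rewrite /cs expr1.
  by rewrite mulf_eq0 negb_or => /andP[].
pose c (n : nat) := if n == 0%N then 0 else cs be n / de.
pose G t := (x (a1 + be * t) - a) / de.
have c_null : null_seq v c.
  move=> e e0; have [N hN] := cs_null be b1_disc _ (mulr_gt0 e0 vde).
  exists N => n /hN; rewrite /c; case: eqP => _ h; first by rewrite nav0 // ltW.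
  by rewrite navM // navV // ler_pdivrMr.
have c1 : v (c 1%N) = 1.
  by rewrite /c /cs /= expr1 navM // navV // u1be mulfV // gt_eqF.
have c_lt1 n : (1 < n)%N -> v (c n) < 1.
  move=> n1; have [_ /(_ n n1) h] := dom be be0 b1_disc.
  rewrite /c gtn_eqF ?(ltnW n1) // navM // navV // ltr_pdivrMr // mul1r.
  by apply: lt_le_trans h _; rewrite /cs expr1 u1be.
have c_le1 n : v (c n) <= 1.
  by case: n => [|[|n]]; [rewrite /c /= nav0 | rewrite c1 | apply/ltW/c_lt1].
have T_le1 n : gauss_le v 1 (trunc c n) by apply: gauss_le_trunc.
have G_cvg t : v t <= 1 -> vcvg v (fun n => (trunc c n).[t]) (G t).
  move=> ht; have h := vcvgD KC (cs_cvg be t b1_disc ht) (vcvg_cst KC (- a)).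
  have := vcvgZ KC de^-1 h; rewrite mulrC -/(G t).
  apply: (vcvg_ext KC (m := 1)) => -[//|n] _.
  rewrite !horner_trunc !big_nat_recl // /c /= mul0r add0r {1}/cs u0 !expr0 !mulr1.
  rewrite addrAC subrr add0r mulr_sumr; apply: eq_bigr => i _.
  by rewrite mulrCA mulrA.
pose dG t := vderiv v x (a1 + be * t) * be / de.
have dT_cauchy := gauss_cauchy_deriv vA (trunc_cauchy vA c_null).
have dG_cvg t : v t <= 1 -> vcvg v (fun n => (trunc c n)^`().[t]) (dG t).
  move=> ht; have [l hl] : exists l, vcvg v (fun n => (trunc c n)^`().[t]) l.
    apply: (vcvg_of_cauchy_le (Cp_complete KC)) => e /dT_cauchy[N hN].
    exists N => m n hm hn; rewrite -hornerN -hornerD.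
    by apply: (gauss_le_horner vA) => //; apply: hN.
  have GD k : v k <= 1 -> v (G (t + k) - G t - k * l) <= v k * v k.
    move=> hk; have htk : v (t + k) <= 1 by apply: navD_le.
    have h1 := vcvgD KC (vcvgD KC (G_cvg _ htk) (vcvgZ KC (-1) (G_cvg t ht)))
      (vcvgZ KC (- k) hl).
    rewrite mulN1r mulNr in h1; apply: (vcvg_le vA h1) => n.
    by rewrite mulN1r mulNr; apply: (difference_quotient KC).
  suff /(vderiv_eq KC) E : is_vderiv v x (a1 + be * t) (l * de / be).
    by rewrite /dG E divfK // mulfK.
  (* The first bound gives |k| <= 1 for k = h / be; the second makes the quadratic remainder, once
     divided by h and rescaled, smaller than e. *)
  move=> e e0; pose d := Num.min (v be) (e * v be * v be / v de).
  exists d; first by rewrite lt_min vbe divr_gt0 ?mulr_gt0.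
  move=> h h0; rewrite lt_min => /andP[hbe hd].
  pose k := h / be; have hk : h = be * k by rewrite mulrC divfK.
  have k0 : k != 0 by rewrite mulf_neq0 ?invr_neq0.
  have vk : 0 < v k by rewrite nav_gt0.
  have k1 : v k <= 1 by rewrite navM // navV // ler_pdivrMr // mul1r ltW.
  have := GD k k1; rewrite /G mulrDr addrA -hk => Gk.
  have -> : (x (a1 + be * t + h) - x (a1 + be * t)) / h - l * de / be =
     ((x (a1 + be * t + h) - a) / de - (x (a1 + be * t) - a) / de - k * l) * (de / (be * k)).
    by rewrite hk; field; rewrite de0 be0 k0.
  rewrite navM // navM // navV // navM //.
  apply: (@le_lt_trans _ _ (v k * v k * (v de / (v be * v k)))).
    by rewrite ler_wpM2r // divr_ge0 ?mulr_ge0 ?nav_ge0.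
  have -> : v k * v k * (v de / (v be * v k)) = v k * v de / v be.
    by field; rewrite !gt_eqF.
  rewrite ltr_pdivrMr // -ltr_pdivlMr //.
  by rewrite /k navM // navV // ltr_pdivrMr // mulrAC.
have G1 : G 1 = 1 by rewrite /G mulr1 a1be x_b1 mulfV.
have G_surj y : v y <= 1 -> exists2 t, v t <= 1 & G t = y.
  move=> hy; have : closed_disc v a r (a + de * y).
    by rewrite /closed_disc /= addrC addKr navM // rE ler_piMr ?nav_ge0.
  move=> /x_surj[t ht E]; exists ((t - a1) / be).
    by rewrite navM // navV // ler_pdivrMr // mul1r disc_small.
  by rewrite /G [be * _]mulrC divfK // [a1 + _]addrC subrK E addrC addKr mulrC mulKf.
(* The factor [de] comes from x - a = de z in the arc mean. In the other mean it cancels the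
   denominator of [dG], leaving the [be] of t - a1 = be z. *)
pose F y := f (a + de * y) * de.
have F_rat : uniform_rational (v := v) F.
  move=> e e0; have [P [Q [Q0 hPQ]]] := f_krasner.
  have [N hN] := hPQ _ (divr_gt0 e0 vde).
  have arcP y : v (y - 1) < 1 -> arc v a b (a + de * y).
    move=> hy; rewrite /arc /= -r_def rE.
    have -> : a + de * y - b = de * (y - 1) by rewrite /de; ring.
    by rewrite navM // gtr_pMr.
  pose S : {poly C} := de *: 'X + a%:P.
  have ev (T : {poly C}) y : (T \Po S).[y] = T.[a + de * y].
    by rewrite horner_comp !hornerE addrC.
  exists (de *: (P N \Po S)), (Q N \Po S); split=> y /arcP hy.
    by rewrite ev Q0.
  rewrite hornerZ !ev /F.
  rewrite (_ : _ - _ = (f (a + de * y) - (P N).[a + de * y] / (Q N).[a + de * y]) * de).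
    rewrite navM // -ler_pdivlMr //.
    by rewrite navBC // ltW // hN.
  by ring.
have [L hL] := means_converge p_prime KC c_null erefl c1 c_lt1 G_cvg dG_cvg G1 G_surj alpha F_rat.
have E1 phi k : arc_mean p a b f phi k = mean (p := p) (phi k) F.
  rewrite /arc_mean /mean /unity_mean; congr (_ * _); apply: eq_fsbigr => z _ /=.
  by rewrite /F -/de; ring.
have E2 phi k : arc_mean p a1 b1 (fun t => f (x t) * vderiv v x t) phi k =
    pullback_mean (p := p) G dG (phi k) F.
  rewrite /arc_mean /pullback_mean /unity_mean; congr (_ * _); apply: eq_fsbigr => z _ /=.
  rewrite /F /G /dG -/be [de * (_ / _)]mulrC divfK // [a + _]addrC subrK.
  by field.
have path l : (0 < l)%N -> exists phi, [/\ family (Phi_ alpha%:Z) phi &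
    forall k, (start phi <= k)%N -> phi k = (alpha + l * k)%N].
  move=> l0; have [phi [_ hphi]] := linear_paths_ex alpha%:Z l0.
  by exists phi; split=> [|k /hphi]; [exists l | lia].
exists L; split=> e e0; have [l [N [l0 h]]] := hL _ (divr_gt0 e0 (ltr0Sn R 1));
  have [phi [Fphi hphi]] := path l l0; exists phi, (maxn (start phi) N);
  split=> //; rewrite ?leq_maxl // => k; rewrite gtn_max => /andP[k1 k2];
  rewrite ?E1 ?E2 hphi 1?ltnW //; have [h1 h2] := h k (ltnW k2).
  by apply: le_lt_trans h1 _; rewrite ltr_pdivrMr // ltr_pMr // ltr1n.
by apply: le_lt_trans h2 _; rewrite ltr_pdivrMr // ltr_pMr // ltr1n.
Qed.
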